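(* Let $A$ be a commutative ring, $M$ an $A$-module, $r\geq1$ an integer and $I$ a finitely generated ideal of $A$. The following are equivalent: (1) $\operatorname{depth}_I(M)\geq r$; (2) there exists a faithfully flat extension $B$ of $A$ and a regular sequence $f_1,\dots,f_r$ on $B\otimes_AM$ contained in $IB$; (3) there exists a polynomial extension $B$ of $A$ and a regular sequence $f_1,\dots,f_r$ on $B\otimes_AM$ contained in $IB$; (4) there exists a regular sequence $f_1,\dots,f_r$ on $M[T_1,\dots,T_r]$, where the $T_i$'s are variables, contained in $IA[T_1,\dots,T_r]$.
   Context: For a finitely generated ideal $I=(a_1,\dots,a_s)$ of $A$ and an $A$-module $M$, $H^i_I(M)$ denotes the $i$-th cohomology module of the Čech complex of $M$ on $a_1,\dots,a_s$ (independent of the generators up to isomorphism), and $\operatorname{depth}_I(M):=\max\{p\in\mathbf{N}\cup\{+\infty\}\mid H^i_I(M)=0\ \forall i<p\}$. No Noetherian or finiteness hypothesis is made on $A$ or $M$. $M[T_1,\dots,T_r]=A[T_1,\dots,T_r]\otimes_AM$. A sequence $f_1,\dots,f_r$ is regular on a module $N$ if each $f_i$ is a non zero divisor on $N/(f_1,\dots,f_{i-1})N$; the quotient $N/(f_1,\dots,f_r)N$ is not required to be nonzero. *)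

(* Defs.v *)
From HB Require Import structures.
From mathcomp Require Import all_boot all_algebra zify.
From mathcomp Require Import boolp classical_sets.
From mathcomp Require Import finmap.
From mathcomp Require Import multinomials.monalg.

Set Implicit Arguments.
Unset Strict Implicit.
Unset Printing Implicit Defensive.

Import GRing.Theory.
Import Quotient.Exports.
Local Open Scope classical_set_scope.
Local Open Scope ring_scope.
Local Open Scope quotient_scope.

(* Rings are [comPzRingType]: the zero ring is allowed throughout.  The ring  *)
(* and module structures that [monalg] puts on [{malg R[K]}] require 1 != 0,  *)
(* hence the copies [freemod] and [malgring] below.                           *)

Section Span.
Context (R : pzRingType) (V : lmodType R).

Definition is_submod (P : set V) : Prop :=
  P 0 /\ forall (a : R) (u v : V), P u -> P v -> P (a *: u + v).

Definition span (X : set V) : set V := smallest is_submod X.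

Lemma sub_span (X : set V) : X `<=` span X.
Proof. exact: sub_smallest. Qed.

Lemma span_submod (X : set V) : is_submod (span X).
Proof.
split=> [P [[P0 _] _] //|a u v Xu Xv P PX].
by apply: PX.1.2; [exact: Xu | exact: Xv].
Qed.

Lemma span_min (X P : set V) : is_submod P -> X `<=` P -> span X `<=` P.
Proof. by move=> subP XP v; apply. Qed.

Definition spanb (X : set V) : V -> bool := fun v => `[< span X v >].

Fact spanb_submod_closed X : submod_closed (spanb X).
Proof.
have [s0 sL] := span_submod X; split=> [|a u v /asboolP su /asboolP sv].
  exact/asboolP.
by apply/asboolP; exact: sL.
Qed.

HB.instance Definition _ X :=
  GRing.isSubmodClosed.Build R V (spanb X) (spanb_submod_closed X).

End Span.

Section QuotMod.
Context (R : pzRingType) (V : lmodType R) (X : set V).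

Local Notation spanz := (GRing.ZmodClosed.clone V (spanb X) _).

(* V / span X *)
Definition quotmod := Quotient.quot spanz.

HB.instance Definition _ := GRing.Zmodule.on quotmod.

Definition quo : V -> quotmod := \pi_(Quotient.quot spanz).

Lemma quo_eq (u v : V) : quo u = quo v <-> span X (u - v).
Proof.
split=> [/eqP|uv]; first by rewrite /quo -Quotient.idealrBE => /asboolP.
by apply/eqP; rewrite /quo -Quotient.idealrBE; apply/asboolP.
Qed.

Lemma quo_eq0 (u : V) : quo u = 0 <-> span X u.
Proof.
rewrite -[u in X in _ <-> X]subr0 -quo_eq; split=> ->.
  by rewrite /quo raddf0.
by rewrite /quo raddf0.
Qed.

Lemma quo_surj (x : quotmod) : exists v, quo v = x.
Proof. by exists (repr x); rewrite /quo reprK. Qed.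

Lemma quoD u v : quo (u + v) = quo u + quo v.
Proof. exact: raddfD. Qed.

Definition quo_scale (a : R) (x : quotmod) : quotmod := quo (a *: repr x).

Lemma quo_scaleE a v : quo_scale a (quo v) = quo (a *: v).
Proof.
apply/quo_eq; rewrite -scalerBr -[_ *: _]addr0; apply: (span_submod X).2.
  by apply/quo_eq; rewrite /quo reprK.
exact: (span_submod X).1.
Qed.

Fact quo_scaleA a b x : quo_scale a (quo_scale b x) = quo_scale (a * b) x.
Proof. by have [v <-] := quo_surj x; rewrite !quo_scaleE scalerA. Qed.
Fact quo_scale1 : left_id 1 quo_scale.
Proof. by move=> x; have [v <-] := quo_surj x; rewrite quo_scaleE scale1r. Qed.
Fact quo_scaleDr : right_distributive quo_scale +%R.
Proof.
move=> a x y; have [u <-] := quo_surj x; have [v <-] := quo_surj y.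
by rewrite -quoD !quo_scaleE scalerDr quoD.
Qed.
Fact quo_scaleDl x : {morph quo_scale^~ x : a b / a + b}.
Proof.
by move=> a b; have [u <-] := quo_surj x; rewrite !quo_scaleE scalerDl quoD.
Qed.

HB.instance Definition _ := GRing.Zmodule_isLmodule.Build R quotmod
  quo_scaleA quo_scale1 quo_scaleDr quo_scaleDl.

Fact quo_is_linear : linear quo.
Proof. by move=> a u v; rewrite quoD -quo_scaleE. Qed.
HB.instance Definition _ := GRing.isLinear.Build R V quotmod *:%R quo
  quo_is_linear.

End QuotMod.

Section FreeMod.
Context (R : pzRingType) (K : choiceType).

Definition freemod : Type := {malg R[K]}.
HB.instance Definition _ := GRing.Zmodule.on freemod.
Implicit Types g : freemod.

Definition free_scale (c : R) g : freemod :=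
  \sum_(k <- msupp g) << c * g@_k *g k >>.

Lemma free_scaleE c g k : (free_scale c g)@_k = c * g@_k.
Proof.
rewrite {2}[g]monalgE !raddf_sum mulr_sumr.
by apply/eq_bigr=> /= i _; rewrite !mcoeffU mulrnAr.
Qed.

Fact free_scaleA c1 c2 g :
  free_scale c1 (free_scale c2 g) = free_scale (c1 * c2) g.
Proof. by apply/malgP=> x; rewrite !free_scaleE mulrA. Qed.
Fact free_scale1 : left_id 1 free_scale.
Proof. by move=> g; apply/malgP=> k; rewrite !free_scaleE mul1r. Qed.
Fact free_scaleDr : right_distributive free_scale +%R.
Proof.
by move=> c g1 g2; apply/malgP=> k; rewrite !(mcoeffD, free_scaleE) mulrDr.
Qed.
Fact free_scaleDl g : {morph free_scale^~ g : a b / a + b}.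
Proof.
by move=> a b; apply/malgP=> k; rewrite !(mcoeffD, free_scaleE) mulrDl.
Qed.

HB.instance Definition _ := GRing.Zmodule_isLmodule.Build R freemod
  free_scaleA free_scale1 free_scaleDr free_scaleDl.

Definition freeb (k : K) : freemod := << 1 *g k >>.

Lemma free_coefZ c g k : (c *: g)@_k = c * g@_k.
Proof. exact: free_scaleE. Qed.

Lemma freebE c k : << c *g k >> = c *: freeb k.
Proof.
by apply/malgP=> k'; rewrite free_coefZ !mcoeffU mulrnAr mulr1.
Qed.

(* the linear map sending the basis vector k to h k *)
Definition free_lift (V : lmodType R) (h : K -> V) (g : freemod) : V :=
  \sum_(k <- msupp g) g@_k *: h k.

Section Lift.
Context (V : lmodType R) (h : K -> V).

Lemma free_liftEw g (d : {fset K}) : (msupp g `<=` d)%fset ->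
  free_lift h g = \sum_(k <- d) g@_k *: h k.
Proof.
move=> le; rewrite /free_lift (big_fset_incl _ le) // => k _.
by move=> /mcoeff_outdom ->; rewrite scale0r.
Qed.

Fact free_lift_is_linear : linear (free_lift h).
Proof.
move=> a u v; pose d := (msupp (a *: u + v) `|` msupp u `|` msupp v)%fset.
rewrite !(@free_liftEw _ d) ?scaler_sumr -?big_split /=.
- by apply: eq_bigr => k _; rewrite mcoeffD free_coefZ scalerDl scalerA.
- by rewrite /d fsubsetUr.
- by rewrite /d -fsetUA fsetUCA fsubsetUl.
- by rewrite /d -fsetUA fsubsetUl.
Qed.
HB.instance Definition _ := GRing.isLinear.Build R freemod V *:%R (free_lift h)
  free_lift_is_linear.

Lemma free_liftb k : free_lift h (freeb k) = h k.
Proof.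
rewrite (free_liftEw (msuppU_le : _ `<=` [fset k])%fset) big_seq_fset1.
by rewrite mcoeffUU scale1r.
Qed.

End Lift.

Lemma freemodE g : g = free_lift freeb g.
Proof.
rewrite [LHS]monalgE; apply: eq_bigr => k _; exact: freebE.
Qed.

End FreeMod.
Arguments free_lift : simpl never.

Section BiadditiveAssoc.
Context (V : zmodType) (m : V -> V -> V).
Local Notation assoc a b c := (m a (m b c) = m (m a b) c).

Lemma assoc0l b c : left_zero 0 m -> assoc 0 b c.
Proof. by move=> m0; rewrite !m0. Qed.
Lemma assoc0m a c : left_zero 0 m -> right_zero 0 m -> assoc a 0 c.
Proof. by move=> m0 m0'; rewrite m0 !m0' m0. Qed.
Lemma assoc0r a b : right_zero 0 m -> assoc a b 0.
Proof. by move=> m0; rewrite !m0. Qed.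
Lemma assocDl u v b c : left_distributive m +%R ->
  assoc u b c -> assoc v b c -> assoc (u + v) b c.
Proof. by move=> mD e1 e2; rewrite !mD e1 e2. Qed.
Lemma assocDm a u v c : left_distributive m +%R -> right_distributive m +%R ->
  assoc a u c -> assoc a v c -> assoc a (u + v) c.
Proof. by move=> mDl mDr e1 e2; rewrite mDl !mDr mDl e1 e2. Qed.
Lemma assocDr a b u v : right_distributive m +%R ->
  assoc a b u -> assoc a b v -> assoc a b (u + v).
Proof. by move=> mD e1 e2; rewrite !mD e1 e2. Qed.

End BiadditiveAssoc.

(* locked: unfolding it during unification diverges *)
HB.lock Definition malg_mul (A : comPzRingType) (K : conomType)
    (g1 g2 : {malg A[K]}) : {malg A[K]} :=
  \sum_(k1 <- msupp g1) \sum_(k2 <- msupp g2)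
     << g1@_k1 * g2@_k2 *g mmul k1 k2 >>.

Section MalgRing.
Context (A : comPzRingType) (K : conomType).

(* the monoid algebra A[K], with the same multiplication as in [monalg] *)
Definition malgring : Type := {malg A[K]}.
HB.instance Definition _ := GRing.Zmodule.on malgring.
Implicit Types g : malgring.

Definition malg_one : malgring := << 1 *g mone >>.
Lemma malg_mulEw (d1 d2 : {fset K}) g1 g2 :
  (msupp g1 `<=` d1)%fset -> (msupp g2 `<=` d2)%fset ->
  malg_mul g1 g2 =
  \sum_(k1 <- d1) \sum_(k2 <- d2) << g1@_k1 * g2@_k2 *g mmul k1 k2 >>.
Proof.
move=> le1 le2; rewrite malg_mul.unlock (big_fset_incl _ le1) /=.
  apply/eq_bigr=> k1 _; apply/big_fset_incl => // k _ /mcoeff_outdom ->.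
  by rewrite mulr0 monalgU0.
move=> k _ /mcoeff_outdom g1k.
by rewrite big1 => // k' _; rewrite g1k mul0r monalgU0.
Qed.

Lemma malg_mulUU (c1 c2 : A) (k1 k2 : K) :
  malg_mul << c1 *g k1 >> << c2 *g k2 >> = << c1 * c2 *g mmul k1 k2 >>.
Proof.
by rewrite (malg_mulEw msuppU_le msuppU_le) !big_seq_fset1 !mcoeffUU.
Qed.

Fact malg_mulC : commutative (@malg_mul A K).
Proof.
move=> g1 g2; rewrite malg_mul.unlock exchange_big /=.
apply/eq_bigr=> k2 _; apply/eq_bigr=> k1 _.
by rewrite mulrC mulmC.
Qed.

Fact malg_mulDl : left_distributive (@malg_mul A K) +%R.
Proof.
move=> g1 g2 g; pose d := (msupp (g1 + g2) `|` msupp g1 `|` msupp g2)%fset.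
rewrite !(@malg_mulEw d (msupp g)) ?fsubset_refl // -?big_split /=.
- apply/eq_bigr=> k1 _; rewrite -big_split /=; apply/eq_bigr=> k2 _.
  by rewrite mcoeffD mulrDl monalgUD.
- by rewrite /d fsubsetUr.
- by rewrite /d -fsetUA fsetUCA fsubsetUl.
- by rewrite /d -fsetUA fsubsetUl.
Qed.

Fact malg_mulDr : right_distributive (@malg_mul A K) +%R.
Proof. by move=> g g1 g2; rewrite !(malg_mulC g) malg_mulDl. Qed.

Lemma malg_mul0l : left_zero 0 (@malg_mul A K).
Proof. by move=> g; rewrite malg_mul.unlock msupp0 big_seq_fset0. Qed.
Lemma malg_mul0r : right_zero 0 (@malg_mul A K).
Proof. by move=> g; rewrite malg_mulC malg_mul0l. Qed.

Lemma malg_ind (P : malgring -> Prop) : P 0 ->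
  (forall u v, P u -> P v -> P (u + v)) -> (forall c k, P << c *g k >>) ->
  forall g, P g.
Proof.
move=> P0 PD PU g; rewrite [g]monalgE.
by elim/big_rec: _ => // k x _; apply: PD.
Qed.

Fact malg_mulA : associative (@malg_mul A K).
Proof.
move=> g1 g2 g3.
elim/malg_ind: g1 => [|u v|c1 k1]; first by apply: assoc0l; exact: malg_mul0l.
  by apply: assocDl; exact: malg_mulDl.
elim/malg_ind: g2 => [|u v|c2 k2].
- by apply: assoc0m; [exact: malg_mul0l | exact: malg_mul0r].
- by apply: assocDm; [exact: malg_mulDl | exact: malg_mulDr].
elim/malg_ind: g3 => [|u v|c3 k3]; first by apply: assoc0r; exact: malg_mul0r.
  by apply: assocDr; exact: malg_mulDr.
by rewrite !malg_mulUU mulrA mulmA.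
Qed.

Fact malg_mul1 : left_id malg_one (@malg_mul A K).
Proof.
move=> g; elim/malg_ind: g => [|u v|c k]; first by rewrite malg_mul0r.
  by rewrite malg_mulDr => -> ->.
by rewrite malg_mulUU mul1r mul1m.
Qed.

HB.instance Definition _ := GRing.Zmodule_isComPzRing.Build malgring
  malg_mulA malg_mulC malg_mul1 malg_mulDl.

Definition malgrC (c : A) : malgring := << c *g mone >>.

Fact malgrC_is_zmod_morphism : zmod_morphism malgrC.
Proof. by move=> a b; rewrite /malgrC monalgUB. Qed.
HB.instance Definition _ := GRing.isZmodMorphism.Build A malgring malgrC
  malgrC_is_zmod_morphism.
Fact malgrC_is_monoid_morphism : monoid_morphism malgrC.
Proof. by split=> // a b; rewrite [RHS]malg_mulUU mul1m. Qed.
HB.instance Definition _ := GRing.isMonoidMorphism.Build A malgring malgrC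
  malgrC_is_monoid_morphism.

End MalgRing.

(* A[T_e, e in E], for an arbitrary set E of variables, and A -> A[T_e]       *)
Notation polyring A E := (malgring A {cmonom E}).
Notation polyringC A E := (@malgrC A {cmonom E}).

Lemma malg_mulE (A : comNzRingType) (K : conomType) (g1 g2 : {malg A[K]}) :
  malg_mul g1 g2 = g1 * g2.
Proof. by rewrite malg_mul.unlock. Qed.

Section Tensor.
Context (A B : comPzRingType) (phi : {rmorphism A -> B}).

Section Module.
Context (M : lmodType A).

Definition tensor_rel : set (freemod B M) :=
  [set x | (exists m n, x = freeb B (m + n) - (freeb B m + freeb B n)) \/
           (exists a m, x = freeb B (a *: m) - phi a *: freeb B m)].

(* B (x)_A M, as the B-module generated by the symbols 1 (x) m subject to the *)
(* A-linearity of m |-> 1 (x) m; see [tensor_liftP] and [tensor_lift_uniq]    *)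
(* for the universal property                                                 *)
Definition tensor := quotmod tensor_rel.
HB.instance Definition _ := GRing.Lmodule.on tensor.

Definition pure (b : B) (m : M) : tensor := b *: quo tensor_rel (freeb B m).

Lemma pure1D m n : pure 1 (m + n) = pure 1 m + pure 1 n.
Proof.
rewrite /pure !scale1r -quoD; apply/quo_eq; apply: sub_span.
by left; exists m, n.
Qed.

Lemma pure1Z a m : pure 1 (a *: m) = phi a *: pure 1 m.
Proof.
rewrite /pure !scale1r -linearZ; apply/quo_eq; apply: sub_span.
by right; exists a, m.
Qed.

Lemma pureE b m : pure b m = b *: pure 1 m.
Proof. by rewrite /pure scale1r. Qed.

(* the B-linear map determined by 1 (x) m |-> h m, when h is A-linear *)
Definition tensor_lift (N : lmodType B) (h : M -> N) (x : tensor) : N :=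
  free_lift h (repr x).

Section Lift.
Context (N : lmodType B) (h : M -> N).
Hypothesis hD : {morph h : m n / m + n}.
Hypothesis hZ : forall a m, h (a *: m) = phi a *: h m.

Lemma tensor_lift_quo g : tensor_lift h (quo tensor_rel g) = free_lift h g.
Proof.
apply/subr0_eq; rewrite -linearB /=.
pose P := [set u : freemod B M | free_lift h u = 0].
suff: span tensor_rel `<=` P.
  by apply; apply/quo_eq; rewrite /quo reprK.
apply: span_min => [|u [[m [n ->]]|[a [m ->]]]]; rewrite /P /=.
- split=> [|a u v /= u0 v0]; first exact: linear0.
  by rewrite linearP /= u0 v0 scaler0 addr0.
- by rewrite linearB linearD /= !free_liftb hD subrr.
- by rewrite linearB linearZ /= !free_liftb hZ subrr.
Qed.

Lemma tensor_lift_linear : linear (tensor_lift h).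
Proof.
move=> b x y; have [u <-] := quo_surj x; have [v <-] := quo_surj y.
by rewrite -linearP !tensor_lift_quo linearP.
Qed.

Lemma tensor_liftP b m : tensor_lift h (pure b m) = b *: h m.
Proof. by rewrite /pure -linearZ tensor_lift_quo linearZ /= free_liftb. Qed.

Lemma tensor_lift_uniq (f : {linear tensor -> N}) :
  (forall m, f (pure 1 m) = h m) -> f =1 tensor_lift h.
Proof.
move=> fh x; have [u <-] := quo_surj x; rewrite tensor_lift_quo.
rewrite [u in LHS]freemodE /free_lift !linear_sum; apply: eq_bigr => m _.
by rewrite !linearZ /= -fh /pure scale1r.
Qed.

End Lift.
End Module.

(* B (x) u *)
Definition tensor_map (M N : lmodType A) (u : {linear M -> N}) :
  tensor M -> tensor N := tensor_lift (fun m => pure 1 (u m)).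

Section Map.
Context (M N : lmodType A) (u : {linear M -> N}).

Let tensor_mapD : {morph (fun m => pure 1 (u m)) : m n / m + n}.
Proof. by move=> m n /=; rewrite (linearD u); exact: pure1D. Qed.
Let tensor_mapZ a m : pure 1 (u (a *: m)) = phi a *: pure 1 (u m).
Proof. by rewrite (linearZ_LR u); exact: pure1Z. Qed.

Fact tensor_map_is_linear : linear (tensor_map u).
Proof.
exact: tensor_lift_linear tensor_mapD tensor_mapZ.
Qed.
HB.instance Definition _ := GRing.isLinear.Build B (tensor M) (tensor N) *:%R
  (tensor_map u) tensor_map_is_linear.

Lemma tensor_map_pure b m : tensor_map u (pure b m) = pure b (u m).
Proof.
rewrite [RHS]pureE; exact: tensor_liftP tensor_mapD tensor_mapZ _ _.
Qed.

End Map.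

Definition exact_seq (R : pzRingType) (V1 V2 V3 : lmodType R)
    (u : {linear V1 -> V2}) (v : {linear V2 -> V3}) : Prop :=
  forall y, v y = 0 <-> exists x, u x = y.

Definition faithfully_flat : Prop :=
  forall (N1 N2 N3 : lmodType A) (u : {linear N1 -> N2}) (v : {linear N2 -> N3}),
    exact_seq u v <-> exact_seq (tensor_map u) (tensor_map v).

End Tensor.

Definition ideal_gen (R : comPzRingType) (X : set R) : set R :=
  span (X : set R^o).

(* the extension IB of the ideal I of A *)
Definition ideal_ext (A B : comPzRingType) (phi : {rmorphism A -> B})
  (I : set A) : set B := ideal_gen (phi @` I).

(* N / JN *)
Definition quot_ideal (R : comPzRingType) (J : set R) (N : lmodType R) :=
  quotmod [set y : N | exists2 b, J b & exists n : N, y = b *: n].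
HB.instance Definition _ R J N := GRing.Lmodule.on (@quot_ideal R J N).

Definition nonzerodivisor (R : comPzRingType) (N : lmodType R) (b : R) : Prop :=
  forall x : N, b *: x = 0 -> x = 0.

Definition regular_seq (R : comPzRingType) (N : lmodType R) (r : nat)
    (f : 'I_r -> R) : Prop :=
  forall i : 'I_r,
    nonzerodivisor
      (quot_ideal (ideal_gen [set f j | j in [set j : 'I_r | (j < i)%N]]) N)
      (f i).

Section Loc.
Context (A : comPzRingType) (M : lmodType A) (a : A).

(* (m, n) stands for the fraction m / a ^ n *)
Definition loc_rel (x y : M * nat) : bool :=
  `[< exists k, a ^+ k *: (a ^+ y.2 *: x.1 - a ^+ x.2 *: y.1) = 0 >].

Lemma loc_relP (x y : M * nat) :
  reflect (exists k, a ^+ (k + y.2) *: x.1 = a ^+ (k + x.2) *: y.1)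
          (loc_rel x y).
Proof.
apply: (iffP (asboolP _)) => -[k e]; exists k.
  by apply/eqP; rewrite -subr_eq0 !exprD -!scalerA -scalerBr e.
by rewrite scalerBr !scalerA -!exprD e subrr.
Qed.

Fact loc_equiv : equiv_class_of loc_rel.
Proof.
split=> [x|x y|y x z].
- by apply/loc_relP; exists 0.
- by apply/loc_relP/loc_relP => -[k e]; exists k.
move=> /loc_relP[k e] /loc_relP[l e']; apply/loc_relP.
exists (k + l + y.2)%N.
have -> : (k + l + y.2 + z.2 = (l + z.2) + (k + y.2))%N by lia.
rewrite exprD -scalerA e scalerA -exprD.
have -> : (l + z.2 + (k + x.2) = (k + x.2) + (l + z.2))%N by lia.
rewrite exprD -scalerA e' scalerA -exprD; congr (_ ^+ _ *: _); lia.
Qed.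
Canonical loc_equiv_rel := EquivRelPack loc_equiv.
Canonical loc_encModRel := defaultEncModRel loc_rel.

Definition loc := {eq_quot loc_rel}.
HB.instance Definition _ : EqQuotient _ loc_rel loc := EqQuotient.on loc.
HB.instance Definition _ := Choice.on loc.

Definition frac (m : M) (n : nat) : loc := \pi_loc (m, n).

Lemma frac_eq m n m' n' : frac m n = frac m' n' <->
  exists k, a ^+ (k + n') *: m = a ^+ (k + n) *: m'.
Proof.
split=> [/eqmodP /loc_relP //|e]; apply/eqmodP; exact/loc_relP.
Qed.

Lemma frac_surj (x : loc) : exists m n, frac m n = x.
Proof.
by exists (repr x).1, (repr x).2; rewrite /frac -surjective_pairing reprK.
Qed.

Lemma frac_exp k m n : frac (a ^+ k *: m) (k + n) = frac m n.
Proof.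
by apply/frac_eq; exists 0; rewrite scalerA -exprD !add0n addnC.
Qed.

Lemma frac_common (x y : loc) :
  exists m m' n, x = frac m n /\ y = frac m' n.
Proof.
have [m [n <-]] := frac_surj x; have [m' [n' <-]] := frac_surj y.
exists (a ^+ n' *: m), (a ^+ n *: m'), (n' + n)%N.
by rewrite frac_exp addnC frac_exp.
Qed.

Definition loc_add (x y : loc) : loc :=
  frac (a ^+ (repr y).2 *: (repr x).1 + a ^+ (repr x).2 *: (repr y).1)
       ((repr x).2 + (repr y).2).
Definition loc_opp (x : loc) : loc := frac (- (repr x).1) (repr x).2.
Definition loc_scale (c : A) (x : loc) : loc := frac (c *: (repr x).1) (repr x).2.

Lemma frac_repr m n : exists k,
  a ^+ (k + n) *: (repr (frac m n)).1 = a ^+ (k + (repr (frac m n)).2) *: m.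
Proof. by apply/frac_eq; rewrite /frac -surjective_pairing reprK. Qed.

Lemma loc_addE m m' n :
  loc_add (frac m n) (frac m' n) = frac (m + m') n.
Proof.
rewrite /loc_add; have [k] := frac_repr m n; have [l] := frac_repr m' n.
move: (repr (frac m n)) (repr (frac m' n)) => [u p] [v q] /= ev eu.
apply/frac_eq; exists (k + l)%N; rewrite !scalerDr !scalerA -!exprD.
have -> : (k + l + n + q = (l + q) + (k + n))%N by lia.
rewrite (exprD a (l + q)) -(scalerA _ _ u) eu.
have -> : (k + l + n + p = (k + p) + (l + n))%N by lia.
rewrite (exprD a (k + p)) -(scalerA _ _ v) ev !scalerA -!exprD.
by congr (_ ^+ _ *: _ + _ ^+ _ *: _); lia.
Qed.

Lemma loc_oppE m n : loc_opp (frac m n) = frac (- m) n.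
Proof.
apply/frac_eq; have [k e] := frac_repr m n.
by exists k; rewrite !scalerN e.
Qed.

Lemma loc_scaleE c m n : loc_scale c (frac m n) = frac (c *: m) n.
Proof.
apply/frac_eq; have [k e] := frac_repr m n; exists k.
by rewrite !scalerA ![_ * c]mulrC -!scalerA e.
Qed.

Lemma loc_common3 (x y z : loc) : exists m m' m'' n,
  [/\ x = frac m n, y = frac m' n & z = frac m'' n].
Proof.
have [m [m' [n [-> ->]]]] := frac_common x y.
have [m'' [p <-]] := frac_surj z.
exists (a ^+ p *: m), (a ^+ p *: m'), (a ^+ n *: m''), (p + n)%N.
by rewrite !frac_exp addnC frac_exp.
Qed.

Fact loc_addA : associative loc_add.
Proof.
move=> x y z; have [m [m' [m'' [n [-> -> ->]]]]] := loc_common3 x y z.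
by rewrite !loc_addE addrA.
Qed.
Fact loc_addC : commutative loc_add.
Proof.
move=> x y; have [m [m' [n [-> ->]]]] := frac_common x y.
by rewrite !loc_addE addrC.
Qed.
Fact loc_add0 : left_id (frac 0 0) loc_add.
Proof.
move=> x; have [m [n <-]] := frac_surj x.
by rewrite -(frac_exp n 0 0) scaler0 addn0 loc_addE add0r.
Qed.
Fact loc_addN : left_inverse (frac 0 0) loc_opp loc_add.
Proof.
move=> x; have [m [n <-]] := frac_surj x.
by rewrite -(frac_exp n 0 0) scaler0 addn0 loc_oppE loc_addE addNr.
Qed.

HB.instance Definition _ := GRing.isZmodule.Build loc
  loc_addA loc_addC loc_add0 loc_addN.

Lemma fracD m m' n : frac (m + m') n = frac m n + frac m' n.
Proof. by rewrite [RHS]loc_addE. Qed.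

Fact loc_scaleA b c x : loc_scale b (loc_scale c x) = loc_scale (b * c) x.
Proof.
by have [m [n <-]] := frac_surj x; rewrite !loc_scaleE scalerA.
Qed.
Fact loc_scale1 : left_id 1 loc_scale.
Proof.
by move=> x; have [m [n <-]] := frac_surj x; rewrite loc_scaleE scale1r.
Qed.
Fact loc_scaleDr : right_distributive loc_scale +%R.
Proof.
move=> c x y; have [m [m' [n [-> ->]]]] := frac_common x y.
by rewrite -fracD !loc_scaleE scalerDr fracD.
Qed.
Fact loc_scaleDl x : {morph loc_scale^~ x : b c / b + c}.
Proof.
move=> b c; have [m [n <-]] := frac_surj x.
by rewrite !loc_scaleE scalerDl fracD.
Qed.

HB.instance Definition _ := GRing.Zmodule_isLmodule.Build A loc
  loc_scaleA loc_scale1 loc_scaleDr loc_scaleDl.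

Lemma fracZ c m n : frac (c *: m) n = c *: frac m n.
Proof. by rewrite [RHS]loc_scaleE. Qed.

End Loc.

(* the map M_b -> M_d, m / b ^ n |-> c ^ n m / d ^ n, meaningful if d = c b *)
Definition loc_map (A : comPzRingType) (M : lmodType A) (b c d : A)
    (x : loc M b) : loc M d :=
  frac d (c ^+ (repr x).2 *: (repr x).1) (repr x).2.

Lemma loc_mapE (A : comPzRingType) (M : lmodType A) (b c d : A) (m : M) n :
  d = c * b -> loc_map c d (frac b m n) = frac d (c ^+ n *: m) n.
Proof.
move=> ->; apply/frac_eq; have [k] := frac_repr b m n.
move: (repr (frac b m n)) => [u p] /= e; exists k.
rewrite !exprMn ![c ^+ (_ + _) * _]mulrC !scalerA.
rewrite -[_ * c ^+ p]mulrA -[_ * c ^+ n in RHS]mulrA -!exprD.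
by rewrite ![b ^+ _ * _]mulrC -!scalerA e -[(k + n + p)%N]addnA (addnC n)
           addnA.
Qed.

Lemma loc_map_linear (A : comPzRingType) (M : lmodType A) (b c d : A) :
  d = c * b -> linear (@loc_map A M b c d).
Proof.
move=> e k x y; have [m [m' [n [-> ->]]]] := frac_common x y.
rewrite -fracZ -fracD !loc_mapE // -fracZ -fracD scalerDr.
by rewrite !scalerA mulrC.
Qed.

Section Prodmod.
Context (A : pzRingType) (I : Type) (V : I -> lmodType A).

Definition prodmod := forall i, V i.
HB.instance Definition _ := Choice.on prodmod.
Implicit Types x y z : prodmod.

Definition prod_zero : prodmod := fun i => 0.
Definition prod_opp x : prodmod := fun i => - x i.
Definition prod_add x y : prodmod := fun i => x i + y i.
Definition prod_scale (a : A) x : prodmod := fun i => a *: x i.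

Fact prod_addA : associative prod_add.
Proof. by move=> x y z; apply: functional_extensionality_dep => i; exact: addrA. Qed.
Fact prod_addC : commutative prod_add.
Proof. by move=> x y; apply: functional_extensionality_dep => i; exact: addrC. Qed.
Fact prod_add0 : left_id prod_zero prod_add.
Proof. by move=> x; apply: functional_extensionality_dep => i; exact: add0r. Qed.
Fact prod_addN : left_inverse prod_zero prod_opp prod_add.
Proof. by move=> x; apply: functional_extensionality_dep => i; exact: addNr. Qed.
HB.instance Definition _ := GRing.isZmodule.Build prodmod
  prod_addA prod_addC prod_add0 prod_addN.

Fact prod_scaleA a b x : prod_scale a (prod_scale b x) = prod_scale (a * b) x.
Proof. by apply: functional_extensionality_dep => i; exact: scalerA. Qed.
Fact prod_scale1 : left_id 1 prod_scale.
Proof. by move=> x; apply: functional_extensionality_dep => i; exact: scale1r. Qed.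
Fact prod_scaleDr : right_distributive prod_scale +%R.
Proof. by move=> a x y; apply: functional_extensionality_dep => i; exact: scalerDr. Qed.
Fact prod_scaleDl x : {morph prod_scale^~ x : a b / a + b}.
Proof. by move=> a b; apply: functional_extensionality_dep => i; exact: scalerDl. Qed.
HB.instance Definition _ := GRing.Zmodule_isLmodule.Build A prodmod
  prod_scaleA prod_scale1 prod_scaleDr prod_scaleDl.

Lemma prodmodE a x y i : (a *: x + y) i = a *: x i + y i.
Proof. by []. Qed.

End Prodmod.

Section Cech.
Context (A : comPzRingType) (s : nat) (a : 'I_s -> A) (M : lmodType A).

Definition cech_mul (S : {set 'I_s}) : A := \prod_(i in S) a i.

(* The whole complex: the direct sum over all S of M localized at the product *)
(* of the a_i, i in S; its part of degree p is the sum over the S with p      *)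
(* elements.                                                                  *)
Definition cech := prodmod (fun S : {set 'I_s} => loc M (cech_mul S)).
HB.instance Definition _ := GRing.Lmodule.on cech.

Definition cech_deg (p : nat) : set cech :=
  [set x : cech | forall S : {set 'I_s}, #|S| <> p -> x S = 0].

Definition cech_diff (x : cech) : cech := fun S =>
  \sum_(k in S) (-1) ^+ #|[pred j in S | (j < k)%N]| *:
    loc_map (a k) (cech_mul S) (x (S :\ k)%SET).

Lemma cech_mulD1 (S : {set 'I_s}) k : k \in S ->
  cech_mul S = a k * cech_mul (S :\ k)%SET.
Proof.
move=> kS; rewrite /cech_mul (bigD1 k) //=; congr (_ * _).
by apply: eq_bigl => j; rewrite !inE andbC.
Qed.

Fact cech_diff_is_linear : linear cech_diff.
Proof.
move=> c x y; apply: functional_extensionality_dep => S.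
rewrite [RHS]prodmodE /cech_diff scaler_sumr -big_split /=.
apply: eq_bigr => k kS.
rewrite prodmodE.
rewrite (loc_map_linear (cech_mulD1 kS)) scalerDr !scalerA.
by rewrite [c * _]mulrC.
Qed.
HB.instance Definition _ := GRing.isLinear.Build A cech cech *:%R cech_diff
  cech_diff_is_linear.

Definition cocycle (p : nat) : cech -> bool :=
  fun x => `[< cech_deg p x /\ cech_diff x = 0 >].

Fact cocycle_submod p : submod_closed (cocycle p).
Proof.
split=> [|c x y /asboolP[xp dx] /asboolP[yp dy]]; apply/asboolP; split.
- by [].
- exact: linear0.
- move=> S Sp; rewrite prodmodE xp // yp //.
  by rewrite scaler0 addr0.
- by rewrite linearP /= dx dy scaler0 addr0.
Qed.
HB.instance Definition _ p := GRing.isSubmodClosed.Build A cech (cocycle p)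
  (cocycle_submod p).

Definition cocycles (p : nat) := {x : cech | cocycle p x}.
HB.instance Definition _ p := SubChoice.on (cocycles p).
HB.instance Definition _ p := [SubChoice_isSubLmodule of cocycles p by <:].

(* empty, hence spanning 0, when p = 0 *)
Definition coboundary (p : nat) : set (cocycles p) :=
  [set z | exists w q, [/\ cech_deg q w, q.+1 = p & val z = cech_diff w]].

(* H^p_I(M), for I the ideal generated by the a_i *)
Definition cech_cohomology (p : nat) := quotmod (@coboundary p).
HB.instance Definition _ p := GRing.Lmodule.on (cech_cohomology p).

Lemma cech_cohomology_eq0 p : (forall h : cech_cohomology p, h = 0) <->
  forall z, cech_deg p z -> cech_diff z = 0 ->
    z = 0 \/ exists w q, [/\ cech_deg q w, q.+1 = p & z = cech_diff w].
Proof.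
split=> [H0 z zp dz|H0 h].
  have zP : cocycle p z by apply/asboolP.
  have /quo_eq0 := H0 (quo _ (exist _ z zP : cocycles p)).
  pose P := [set u : cocycles p | val u = 0 \/ coboundary u].
  suff subP : span (@coboundary p) `<=` P by move=> /subP.
  apply: span_min => [|u]; last by right.
  split=> [|c u v]; first by left.
  rewrite /P /coboundary /= => -[u0|[w [q [wq qp uw]]]] [v0|[w' [q' [wq' qp' vw]]]].
  - by left; rewrite u0 v0 scaler0 addr0.
  - right; exists w', q'; split=> //.
    by rewrite u0 scaler0 add0r.
  - right; exists (c *: w), q; split=> //.
      by move=> S /wq; rewrite -[c *: w]addr0 prodmodE => ->; rewrite scaler0 addr0.
    by rewrite v0 addr0 uw linearZ.
  - have qq : q' = q by move: qp'; rewrite -qp => -[].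
    right; exists (c *: w + w'), q; split=> //.
      move=> S Sq; rewrite prodmodE wq // scaler0 add0r.
      by rewrite qq in wq'; exact: wq'.
    by rewrite linearP uw vw.
have [z <-] := quo_surj h; apply/quo_eq0.
have /asboolP[zp dz] := valP z.
have [z0|bz] := H0 _ zp dz; last exact: sub_span.
suff -> : z = 0 by exact: (span_submod _).1.
exact: val_inj.
Qed.

(* N together with +oo, which is None *)
Definition enat := option nat.

Definition enat_le (p q : enat) : bool :=
  match p, q with
  | _, None => true
  | None, Some _ => false
  | Some m, Some n => (m <= n)%N
  end.

Definition enat_gt_nat (p : enat) (i : nat) : bool :=
  if p is Some n then (i < n)%N else true.

(* the p such that H^i_I(M) = 0 for all i < p *)
Definition depth_set : set enat :=
  [set p | forall i, enat_gt_nat p i -> forall h : cech_cohomology i, h = 0].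

Lemma depth_exists :
  exists p, depth_set p /\ forall q, depth_set q -> enat_le q p.
Proof.
have [H0|] := pselect (forall i (h : cech_cohomology i), h = 0).
  by exists None; split=> [i _|[]//]; exact: H0.
move=> /existsNP[i0 Hi0].
have ex0 : exists i, ~~ `[< forall h : cech_cohomology i, h = 0 >].
  by exists i0; exact/asboolPn.
case: (ex_minnP ex0) => n /asboolPn Hn nmin.
exists (Some n); split=> [i /= lt_in|[m|] /= Hm].
- apply: contrapT => Hi; have := nmin i; rewrite leqNgt lt_in.
  by have /asboolPn -> := Hi => /(_ isT).
- by rewrite leqNgt; apply/negP => lt_nm; exact: Hn (Hm n lt_nm).
- by case: (Hn (Hm n isT)).
Qed.

(* depth_I(M) for I the ideal generated by the a_i, as the largest element of *)
(* [depth_set]                                                                *)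
Definition depth : enat := sval (cid depth_exists).

Lemma depthP : depth_set depth /\ forall q, depth_set q -> enat_le q depth.
Proof. exact: svalP (cid depth_exists). Qed.

Lemma depth_geP (r : nat) : enat_le (Some r) depth <->
  forall i, (i < r)%N -> forall h : cech_cohomology i, h = 0.
Proof.
have [dP dmax] := depthP; split=> [le_rd i lt_ir|Hr]; last exact: dmax.
by apply: dP; move: le_rd; case: depth => [n|//] /=; exact: leq_trans.
Qed.

End Cech.

(* Main.v *)
Require Import Defs.
From HB Require Import structures.
From mathcomp Require Import all_boot all_algebra.
From mathcomp Require Import boolp classical_sets.
From mathcomp Require Import finmap.
From mathcomp Require Import multinomials.monalg.

Set Implicit Arguments.
Unset Strict Implicit.
Unset Printing Implicit Defensive.

Import GRing.Theory.
Local Open Scope classical_set_scope.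
Local Open Scope ring_scope.

(** A Čech cochain has finitely many components, each a fraction, so the Čech
    complex of the a_k on M is the colimit over n of the Koszul complexes of the
    powers a_k ^ n ([kdiff], [ktrans]).  The vanishing of its cohomology in
    degree i then reads: every Koszul cocycle of degree i becomes a coboundary
    once the exponents are raised ([acyclic], [cech_acyclic]).  No localization
    occurs after this translation.  Working modulo a submodule J of M gives the
    same condition for M / J by congruences, without forming the quotient.

    Two halves of the long exact sequence of multiplication by f, when f is a
    nonzerodivisor modulo J, compare J and J + fM.  If M / J is acyclic in
    degrees i and i + 1 then M / (J + fM) is acyclic in degree i
    ([acyclic_add_mul]).  Conversely, if f lies in the ideal of the a_k and
    M / (J + fM) is acyclic in degree i - 1 then M / J is acyclic in degree i
    ([acyclic_of_add_mul]): the Koszul homotopies ([koszul_homotopy]) make f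
    nilpotent on each class, and the hypothesis allows f to be cancelled.

    A regular sequence of length r in IB on the scalar extension of M to B
    thus forces acyclicity there in degrees below r, by descending along the
    quotients ([acyclic_of_regular_seq]).  If B is faithfully flat over A, this
    descends to M ([acyclic_descent]): whether a given cochain is a coboundary
    is the vanishing of an element of a cokernel, which faithful flatness
    detects.

    Conversely, acyclicity of M in degrees below r passes to M[T_1, ..., T_r],
    coefficient by coefficient ([acyclic_malgmod]).  There the elements
    f_j = sum_k a_k T_j^k are a regular sequence ([generic_seq_regular]).  The
    relations f_1, ..., f_(j-1) do not involve T_j, so McCoy's argument applies
    modulo them: if f_j killed a nonzero element, some nonzero multiple of it would
    be killed by all the a_k ([generic_elt_torsion]), against the vanishing in
    degree 0.  One then passes to the next quotient by [acyclic_add_mul].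

    Polynomial extensions are faithfully flat ([malgrC_faithfully_flat]), since
    the scalar extension of a linear map acts on each coefficient separately;
    this closes the circle of implications. *)

(** * Submodules *)

Section Submodules.
Context (R : pzRingType) (N : lmodType R) (J : set N).
Hypothesis JP : is_submod J.

Lemma submod0 : J 0.
Proof. exact: JP.1. Qed.

Lemma submodZ c x : J x -> J (c *: x).
Proof. by move=> Jx; rewrite -[_ *: _]addr0; apply: JP.2 => //; exact: submod0. Qed.

Lemma submodD x y : J x -> J y -> J (x + y).
Proof. by move=> Jx Jy; rewrite -[x]scale1r; apply: JP.2. Qed.

Lemma submodN x : J x -> J (- x).
Proof. by rewrite -scaleN1r; exact: submodZ. Qed.

Lemma submodB x y : J x -> J y -> J (x - y).
Proof. by move=> Jx Jy; apply: submodD => //; exact: submodN. Qed.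

Lemma submod_sum (T : Type) (r : seq T) (P : pred T) (F : T -> N) :
  (forall i, P i -> J (F i)) -> J (\sum_(i <- r | P i) F i).
Proof. by move=> H; elim/big_ind: _ => //; [exact: submod0|exact: submodD]. Qed.

End Submodules.

(** * Koszul complexes *)

Section Koszul.
Context (R : comPzRingType) (s : nat) (a : 'I_s -> R).

Definition ksign (k : 'I_s) (S : {set 'I_s}) : R :=
  (-1) ^+ #|[pred j in S | (j < k)%N]|.

Lemma ksign_sq k S : ksign k S * ksign k S = 1.
Proof. by rewrite /ksign -expr2 sqrr_sign. Qed.

(** If k < l then removing k lowers the position of l by one, while removing l
    does not change the position of k. *)
Lemma ksign_swap k l (S : {set 'I_s}) : k != l -> k \in S -> l \in S ->
  ksign k S * ksign l (S :\ k)%SET = - (ksign l S * ksign k (S :\ l)%SET).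
Proof.
wlog lt_kl : k l / (k < l)%N.
  move=> H kl kS lS; have [lt|lt|/val_inj e] := ltngtP k l.
  - exact: H.
  - by rewrite (H l k) ?opprK 1?eq_sym.
  - by rewrite e eqxx in kl.
move=> kl kS lS; rewrite /ksign.
have -> : #|[pred j in S | (j < l)%N]| = (#|[pred j in (S :\ k)%SET | (j < l)%N]|).+1.
  rewrite (cardD1 k) inE /= kS lt_kl add1n; congr _.+1.
  by apply: eq_card => j; rewrite !inE andbA.
have -> : #|[pred j in (S :\ l)%SET | (j < k)%N]| = #|[pred j in S | (j < k)%N]|.
  apply: eq_card => j; rewrite !inE; case: (eqVneq j l) => // ->.
  by rewrite [(l < k)%N]ltnNge (ltnW lt_kl) ?andbF.
by rewrite exprS mulN1r mulNr opprK mulrC.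
Qed.

Section Complex.
Context (N : lmodType R).

Definition cochain := {ffun {set 'I_s} -> N}.

HB.instance Definition _ := GRing.Lmodule.on cochain.

(** The Koszul differential on the powers a_k ^ n. *)
Definition kdiff (n : nat) (x : cochain) : cochain :=
  [ffun S : {set 'I_s} =>
     \sum_(k in S) (ksign k S * a k ^+ n) *: x (S :\ k)%SET].

(** The transition map from the exponents n to the exponents n + e; the
    Čech complex is the colimit of the Koszul complexes along these maps. *)
Definition ktrans (e : nat) (x : cochain) : cochain :=
  [ffun S : {set 'I_s} => cech_mul a S ^+ e *: x S].

Definition kdeg (i : nat) (x : cochain) : Prop :=
  forall S : {set 'I_s}, #|S| <> i -> x S = 0.

(** Degree i - 1; for i = 0 this leaves only the zero cochain, so that no case
    distinction is needed to speak of the coboundaries of degree 0. *)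
Definition kdeg_pred (i : nat) (x : cochain) : Prop :=
  forall S : {set 'I_s}, #|S|.+1 <> i -> x S = 0.

(** Contraction with the index k. *)
Definition khom (k : 'I_s) (x : cochain) : cochain :=
  [ffun S : {set 'I_s} =>
     if k \in S then 0 else ksign k (k |: S)%SET *: x (k |: S)%SET].

Fact kdiff_is_linear n : linear (kdiff n).
Proof.
move=> c x y; apply/ffunP => S; rewrite !ffunE scaler_sumr -big_split /=.
by apply: eq_bigr => k _; rewrite !ffunE scalerDr !scalerA (mulrC c).
Qed.
HB.instance Definition _ n :=
  GRing.isLinear.Build R cochain cochain *:%R (kdiff n) (kdiff_is_linear n).

Fact ktrans_is_linear e : linear (ktrans e).
Proof.
by move=> c x y; apply/ffunP => S; rewrite !ffunE scalerDr !scalerA (mulrC c).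
Qed.
HB.instance Definition _ e :=
  GRing.isLinear.Build R cochain cochain *:%R (ktrans e) (ktrans_is_linear e).

Fact khom_is_linear k : linear (khom k).
Proof.
move=> c x y; apply/ffunP => S; rewrite !ffunE; case: ifP => _.
  by rewrite scaler0 addr0.
by rewrite scalerDr !scalerA (mulrC c).
Qed.
HB.instance Definition _ k :=
  GRing.isLinear.Build R cochain cochain *:%R (khom k) (khom_is_linear k).

(** The double sum over the pairs of indices is antisymmetric by [ksign_swap]. *)
Lemma kdiff_kdiff n x : kdiff n (kdiff n x) = 0.
Proof.
apply/ffunP => S; rewrite !ffunE.
pose F (k l : 'I_s) := (ksign k S * a k ^+ n) *:
  ((ksign l (S :\ k)%SET * a l ^+ n) *: x ((S :\ k) :\ l)%SET).
have FN k l : k \in S -> l \in S -> k != l -> F k l = - F l k.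
  move=> kS lS kl; rewrite /F !scalerA -scaleNr.
  have -> : ((S :\ k) :\ l)%SET = ((S :\ l) :\ k)%SET.
    by apply/setP => j; rewrite !inE andbCA.
  congr (_ *: _).
  by rewrite mulrACA [in RHS]mulrACA ksign_swap // mulNr [a l ^+ n * _]mulrC.
under eq_bigr => k _ do rewrite ffunE scaler_sumr.
rewrite (eq_bigr (fun k : 'I_s => \sum_(l in S | l != k) F k l)); last first.
  by move=> k _; apply: eq_bigl => l; rewrite !inE andbC.
(* The pairs with l < k are matched with those with k < l. *)
under eq_bigr => k _ do rewrite (bigID (fun l : 'I_s => (l < k)%N)) /=.
rewrite big_split /=.
rewrite [X in _ + X](eq_bigr
  (fun k : 'I_s => \sum_(l in S | (k < l)%N) F k l)); last first.
  move=> k _; apply: eq_bigl => l; rewrite -andbA; congr (_ && _).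
  by rewrite -leqNgt ltn_neqAle eq_sym.
rewrite [X in X + _](eq_bigr
  (fun k : 'I_s => \sum_(l in S | (l < k)%N) F k l)); last first.
  move=> k _; apply: eq_bigl => l; rewrite -andbA; congr (_ && _).
  by case: eqVneq => // ->; rewrite ltnn.
rewrite [X in _ + X](exchange_big_dep (mem S)) /=; last by move=> ? ? _ /andP[].
rewrite -big_split big1 //= => k kS.
rewrite [X in _ + X](eq_bigl (fun l => (l \in S) && (l < k)%N)); last first.
  by move=> l; rewrite /= kS.
rewrite -big_split big1 //= => l /andP[lS lt_lk].
by rewrite FN ?addNr // neq_ltn lt_lk orbT.
Qed.

Lemma ktransD e e' x : ktrans e' (ktrans e x) = ktrans (e + e') x.
Proof. by apply/ffunP => S; rewrite !ffunE scalerA -exprD addnC. Qed.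

Lemma ktrans0 x : ktrans 0 x = x.
Proof. by apply/ffunP => S; rewrite !ffunE scale1r. Qed.

Lemma ktrans_kdiff n e x : ktrans e (kdiff n x) = kdiff (n + e) (ktrans e x).
Proof.
apply/ffunP => S; rewrite !ffunE scaler_sumr; apply: eq_bigr => k kS.
rewrite ffunE !scalerA (cech_mulD1 a kS) exprMn exprD.
by congr (_ *: _); rewrite mulrC !mulrA.
Qed.

(** At a set S which does not contain k, the terms for the indices l in S cancel
    in pairs by [ksign_swap]; at a set which contains k, only the term of index
    k is left. *)
Lemma koszul_homotopy n k x :
  kdiff n (khom k x) + khom k (kdiff n x) = a k ^+ n *: x.
Proof.
apply/ffunP => S; rewrite ffunE [kdiff n _ S]ffunE [khom k _ S]ffunE [RHS]ffunE.
case: ifPn => kS.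
  rewrite addr0 (bigD1 k) //= big1 ?addr0 => [|l /andP[lS lk]]; last first.
    by rewrite ffunE !inE kS eq_sym lk scaler0.
  rewrite ffunE !inE eqxx /= finset.setD1K // scalerA.
  by rewrite mulrAC ksign_sq mul1r.
rewrite [kdiff n x _]ffunE big_setU1 //= scalerDr scalerA mulrA ksign_sq mul1r.
rewrite finset.setU1K // addrCA scaler_sumr -big_split big1 ?addr0 //= => l lS.
have lk : l != k by apply: contraNneq kS => <-.
rewrite ffunE !inE (negPf kS) andbF !scalerA.
have -> : (k |: S :\ l = (k |: S) :\ l)%SET.
  by apply/setP => j; rewrite !inE; case: (eqVneq j k) => // ->; rewrite eq_sym lk.
rewrite -scalerDl (_ : _ + _ = 0) ?scale0r //.
set T := (k |: S)%SET.
have kT : k \in T by rewrite !inE eqxx.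
have lT : l \in T by rewrite !inE lS orbT.
have kl : k != l by rewrite eq_sym.
have := ksign_swap kl kT lT.
have -> : (T :\ k = S)%SET by rewrite finset.setU1K.
move=> e; have {}e : ksign l S * ksign k (T :\ l)%SET = - (ksign k T * ksign l T).
  rewrite -[LHS]mul1r -(ksign_sq k T) [in LHS]mulrACA e mulNr mulrACA ksign_sq mulr1.
  by rewrite mulrC.
by rewrite mulrAC e mulrA mulNr addNr.
Qed.

Lemma khom_deg k i x : kdeg i x -> kdeg_pred i (khom k x).
Proof.
move=> xi S Si; rewrite ffunE; case: ifPn => // kS.
by rewrite xi ?scaler0 // cardsU1 kS add1n.
Qed.

Lemma kdiff_deg n i x : kdeg i x -> kdeg i.+1 (kdiff n x).
Proof.
move=> xi S Si; rewrite ffunE big1 // => k kS.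
by rewrite xi ?scaler0 // => e; apply: Si; rewrite (cardsD1 k) kS e.
Qed.

Lemma kdiff_deg_pred n i x : kdeg_pred i x -> kdeg i (kdiff n x).
Proof.
move=> xi S Si; rewrite ffunE big1 // => k kS.
by rewrite xi ?scaler0 // => e; apply: Si; rewrite (cardsD1 k) kS.
Qed.

Lemma cochainB (x y : cochain) S : (x - y) S = x S - y S.
Proof. by rewrite !ffunE. Qed.

Lemma cochainZ c (x : cochain) S : (c *: x) S = c *: x S.
Proof. by rewrite ffunE. Qed.

Lemma ktrans_eq0 e (x : cochain) S : x S = 0 -> ktrans e x S = 0.
Proof. by move=> xS; rewrite ffunE xS scaler0. Qed.

End Complex.

(** * Acyclicity of the Koszul systems modulo a submodule *)

Section Acyclic.
Context (N : lmodType R).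
Implicit Types (J : set N) (x w : cochain N) (z : N).

Definition kmod J : set (cochain N) := [set x | forall S, J (x S)].

(** The vanishing of the i-th cohomology of the colimit of the Koszul complexes
    of N / J, written as congruences modulo J. *)
Definition acyclic J (i : nat) : Prop :=
  forall n x, kdeg i x ->
    kmod J (kdiff n x) ->
  exists e w, kdeg_pred i w /\
    kmod J (ktrans e x - kdiff (n + e) w).

(** The submodule J + fN. *)
Definition add_mul J (f : R) : set N := [set z | exists y, J (z - f *: y)].

Section Submod.
Context (J : set N).
Hypothesis JP : is_submod J.

Lemma kmod_submod : is_submod (kmod J).
Proof.
split=> [S|c x y Jx Jy S]; first by rewrite ffunE; exact: submod0.
by rewrite !ffunE; apply: JP.2.
Qed.

Lemma kmod_kdiff n x : kmod J x -> kmod J (kdiff n x).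
Proof.
by move=> Jx S; rewrite ffunE; apply: submod_sum => // k _; exact: submodZ.
Qed.

Lemma kmod_ktrans e x : kmod J x -> kmod J (ktrans e x).
Proof. by move=> Jx S; rewrite ffunE; exact: submodZ. Qed.

Lemma kmod_khom k x : kmod J x -> kmod J (khom k x).
Proof.
move=> Jx S; rewrite ffunE; case: ifP => _; first exact: submod0.
exact: submodZ.
Qed.

Lemma add_mul_sub f : J `<=` add_mul J f.
Proof. by move=> z Jz; exists 0; rewrite scaler0 subr0. Qed.

Lemma add_mul_mul f z : add_mul J f (f *: z).
Proof. by exists z; rewrite subrr; exact: submod0. Qed.

Lemma add_mul_submod f : is_submod (add_mul J f).
Proof.
split=> [|c z z' [u zu] [v zv]]; first by apply: add_mul_sub; exact: submod0.
exists (c *: u + v); rewrite scalerDr scalerA (mulrC f) -scalerA.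
by rewrite opprD addrACA -scalerBr; apply: JP.2.
Qed.

Lemma kmod_add_mul f x : kmod (add_mul J f) x ->
  exists w, kmod J (x - f *: w) /\ forall S, x S = 0 -> w S = 0.
Proof.
move=> Jx.
have /choice[w wP] S : exists y, J (x S - f *: y) /\ (x S = 0 -> y = 0).
  have [xS0|xS0] := eqVneq (x S) 0.
    by exists 0; rewrite xS0 scaler0 subr0; split=> //; exact: submod0.
  by have [y Jy] := Jx S; exists y; split=> // e; rewrite e eqxx in xS0.
exists [ffun S => w S]; split=> S; last by rewrite ffunE; exact: (wP S).2.
by rewrite !ffunE; exact: (wP S).1.
Qed.

End Submod.

(** A diagram chase in 0 -> N/J -> N/J -> N/(J + fN) -> 0: a cocycle x modulo
    J + fN has a differential of the form f w; since w is a cocycle of degree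
    i + 1, it is a coboundary, and x can be corrected to a cocycle modulo J. *)
Lemma acyclic_add_mul J f i : is_submod J ->
  (forall z, J (f *: z) -> J z) -> acyclic J i -> acyclic J i.+1 ->
  acyclic (add_mul J f) i.
Proof.
move=> JP Jf Hi Hi1 n x xi dx.
have KP := kmod_submod JP.
have [w [dxw w0]] := kmod_add_mul JP dx.
have wi : kdeg i.+1 w by move=> S Si; apply: w0; exact: kdiff_deg Si.
have dw : kmod J (kdiff n w).
  move=> S; apply: Jf; have := kmod_kdiff JP n dxw S.
  rewrite linearB /= kdiff_kdiff sub0r linearZ /= !ffunE => /(submodN JP).
  by rewrite opprK.
have [e [v [vi wv]]] := Hi1 n w wi dw.
pose x' := ktrans e x - f *: v.
have x'i : kdeg i x'.
  move=> S Si; rewrite !ffunE xi // vi ?scaler0 ?subr0 // => -[]; exact: Si.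
have dx' : kmod J (kdiff (n + e) x').
  rewrite /x' linearB linearZ /= -ktrans_kdiff.
  have -> : ktrans e (kdiff n x) - f *: kdiff (n + e) v =
    ktrans e (kdiff n x - f *: w) + f *: (ktrans e w - kdiff (n + e) v).
    rewrite [ktrans e (_ - _)]linearB /= [ktrans e (_ *: _)]linearZ /=.
    by rewrite scalerBr addrA subrK.
  by apply: (submodD KP); [exact: (kmod_ktrans JP)|exact: (submodZ KP)].
have [e' [u [ui Hu]]] := Hi _ _ x'i dx'.
exists (e + e')%N, u; split=> //; rewrite -ktransD addnA.
have -> : ktrans e' (ktrans e x) - kdiff (n + e + e') u =
  ktrans e' x' - kdiff (n + e + e') u + f *: ktrans e' v.
  by rewrite /x' linearB linearZ /= addrAC subrK.
have KP' := kmod_submod (add_mul_submod JP f).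
apply: (submodD KP'); last first.
  by move=> S; rewrite ffunE; exact: (add_mul_mul JP).
by move=> S; exact: add_mul_sub.
Qed.

(** The c for which c x is a coboundary form an ideal, which contains the
    a_k ^ n by [koszul_homotopy]; so its radical contains the ideal of the
    a_k. *)
Lemma ideal_nilp_coboundary J i n x f : is_submod J ->
  kdeg i x -> kmod J (kdiff n x) ->
  ideal_gen (range a) f ->
  exists m w, kdeg_pred i w /\
    kmod J (f ^+ m *: x - kdiff n w).
Proof.
move=> JP xi dx fI; have KP := kmod_submod JP.
pose b := [set c : R^o | exists2 w, kdeg_pred i w & kmod J (c *: x - kdiff n w)].
have bP : is_submod b.
  split=> [|c u v [w Dw uw] [w' Dw' vw]].
    exists 0; first by move=> S _; rewrite ffunE.
    by rewrite scale0r linear0 subr0; exact: submod0.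
  exists (c *: w + w'); first by move=> S Si; rewrite !ffunE Dw // Dw' // scaler0 addr0.
  rewrite linearP scalerDl -scalerA opprD addrACA -scalerBr.
  exact: KP.2.
pose rb := [set c : R^o | exists m, b (c ^+ m)].
suff sub : ideal_gen (range a) `<=` rb.
  by have [m [w Dw]] := sub _ fI; exists m, w.
apply: (@span_min _ R^o) => [|_ [k _ <-]]; last first.
  exists n, (khom k x); first exact: khom_deg.
  suff: kmod J (a k ^+ n *: x - kdiff n (khom k x)) by [].
  rewrite -koszul_homotopy addrAC subrr add0r.
  exact: (kmod_khom JP).
split=> [|c u v [m um] [m' vm']]; first by exists 1%N; exact: submod0 bP.
have cum : b ((c * u : R) ^+ m) by rewrite exprMn; exact: submodZ bP _ _ um.
exists (m + m')%N; rewrite exprDn; apply: (submod_sum bP) => l _.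
rewrite -scaler_nat; apply: (submodZ bP).
have [lt_lm|le_ml] := ltnP l m'.
  have -> : (m + m' - l = (m' - l) + m)%N by rewrite -addnBA ?(ltnW lt_lm) // addnC.
  by rewrite exprD mulrAC; exact: submodZ bP _ _ cum.
by rewrite -(subnK le_ml) exprD mulrA; exact: submodZ bP _ _ vm'.
Qed.

(** By [ideal_nilp_coboundary], a cocycle x becomes a coboundary after
    multiplication by a power of f, and the factors f are cancelled one at a
    time: if f x is the differential of w then w is a cocycle modulo J + fN,
    hence a coboundary there, and w may be replaced by a multiple f u, so that
    x is the differential of u. *)
Lemma acyclic_of_add_mul J f i : is_submod J -> ideal_gen (range a) f ->
  (forall z, J (f *: z) -> J z) ->
  (forall j, j.+1 = i -> acyclic (add_mul J f) j) -> acyclic J i.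
Proof.
move=> JP fI Jf Hi n x xi dx; have KP := kmod_submod JP.
have [m [w [wi xw]]] := ideal_nilp_coboundary JP xi dx fI.
elim: m n x w xi dx wi xw => [|m IH] n x w xi dx wi xw.
  by exists 0, w; rewrite ktrans0 addn0; rewrite scale1r in xw.
suff [e [u [ui Hu]]] : exists e u, kdeg_pred i u /\
    kmod J (f ^+ m *: ktrans e x - kdiff (n + e) u).
  have tx : kdeg i (ktrans e x) by move=> S Si; apply: ktrans_eq0; exact: xi.
  have dtx : kmod J (kdiff (n + e) (ktrans e x)).
    by rewrite -ktrans_kdiff; exact: (kmod_ktrans JP).
  have [e' [v [vi Hv]]] := IH _ _ _ tx dtx ui Hu.
  by exists (e + e')%N, v; rewrite -ktransD addnA.
have [i0|[j ji]] : i = 0%N \/ exists j, j.+1 = i.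
  by case: (i) => [|j]; [left|right; exists j].
  exists 0, 0; split=> [S _|S]; first by rewrite ffunE.
  rewrite linear0 subr0 ktrans0; apply: Jf; have := xw S.
  rewrite !ffunE exprS -scalerA big1 ?subr0 // => k _.
  by rewrite wi ?scaler0 // i0.
have wj : kdeg j w by move=> S Sj; apply: wi; rewrite -ji => -[].
have dw : kmod (add_mul J f) (kdiff n w).
  move=> S; exists ((f ^+ m *: x) S).
  by have := submodN KP xw S; rewrite !ffunE opprB exprS -scalerA.
have [e [v [vj wv]]] := Hi j ji n w wj dw.
have [u [wu u0]] := kmod_add_mul JP wv.
exists e, u; split=> [S Si|S].
  apply: u0; rewrite cochainB ktrans_eq0 ?wi // (kdiff_deg_pred _ vj) ?subrr //.
  by move=> Sj; apply: Si; rewrite Sj.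
apply: Jf; rewrite -cochainZ; move: S.
suff: kmod J (f *: (f ^+ m *: ktrans e x - kdiff (n + e) u)) by [].
have -> : f *: (f ^+ m *: ktrans e x - kdiff (n + e) u) =
    ktrans e (f ^+ m.+1 *: x - kdiff n w) +
    kdiff (n + e) (ktrans e w - kdiff (n + e) v - f *: u).
  rewrite [kdiff (n + e) (_ - _)]linearB /=.
  rewrite [kdiff (n + e) (ktrans e w - _)]linearB /= kdiff_kdiff subr0.
  rewrite [kdiff (n + e) (_ *: _)]linearZ /= -ktrans_kdiff.
  rewrite [ktrans e (_ - _)]linearB /= [ktrans e (_ *: _)]linearZ /=.
  by rewrite addrA subrK scalerBr scalerA -exprS.
by apply: (submodD KP); [exact: (kmod_ktrans JP)|exact: (kmod_kdiff JP)].
Qed.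

End Acyclic.
End Koszul.

(** * From Koszul systems to Čech cohomology *)

Section CechKoszul.
Context (R : comPzRingType) (s : nat) (a : 'I_s -> R) (N : lmodType R).
Implicit Types (x w : cochain s N).

Lemma frac0 (b : R) n : Defs.frac b (0 : N) n = 0.
Proof. by rewrite -(scale0r 0) fracZ scale0r. Qed.

Definition cech_frac (n : nat) x : cech a N :=
  fun S => Defs.frac (cech_mul a S) (x S) n.

Lemma cech_fracB n x w : cech_frac n (x - w) = cech_frac n x - cech_frac n w.
Proof.
apply: functional_extensionality_dep => S; rewrite /cech_frac cochainB fracD.
by congr (_ + _); rewrite -scaleN1r fracZ scaleN1r.
Qed.

Lemma cech_frac0 n : cech_frac n 0 = 0.
Proof.
by apply: functional_extensionality_dep => S; rewrite /cech_frac ffunE frac0.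
Qed.

Lemma cech_frac_ktrans n e x : cech_frac (n + e) (ktrans a e x) = cech_frac n x.
Proof.
apply: functional_extensionality_dep => S.
by rewrite /cech_frac ffunE addnC frac_exp.
Qed.

Lemma cech_diff_frac n x : cech_diff (cech_frac n x) = cech_frac n (kdiff a n x).
Proof.
apply: functional_extensionality_dep => S; rewrite /cech_diff /cech_frac ffunE.
rewrite (big_morph (fun z => Defs.frac _ z n) (id1 := 0) (op1 := +%R)) /=; first last.
- exact: frac0.
- by move=> z z'; rewrite fracD.
apply: eq_bigr => k kS; rewrite (loc_mapE _ _ (cech_mulD1 a kS)) -scalerA [RHS]fracZ.
by [].
Qed.

(** The finitely many components have a common exponent. *)
Lemma cech_frac_surj (z : cech a N) : exists n x,
  cech_frac n x = z /\ forall i, cech_deg i z -> kdeg i x.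
Proof.
have /choice[mn mnP] S : exists mn : N * nat,
    Defs.frac (cech_mul a S) mn.1 mn.2 = z S /\ (z S = 0 -> mn.1 = 0).
  have [zS|zS] := pselect (z S = 0).
    exists (0, 0%N); by split=> //=; rewrite zS frac0.
  by have [m [n mn]] := frac_surj (z S); exists (m, n).
pose n := (\max_S (mn S).2)%N.
have le_n S : ((mn S).2 <= n)%N by exact: leq_bigmax.
exists n, [ffun S => cech_mul a S ^+ (n - (mn S).2) *: (mn S).1]; split.
  apply: functional_extensionality_dep => S.
  rewrite /cech_frac ffunE -[n in Defs.frac _ _ n](subnK (le_n S)) frac_exp.
  exact: (mnP S).1.
by move=> i zi S Si; rewrite ffunE (mnP S).2 ?scaler0 // zi.
Qed.

Lemma cech_frac_eq0 n x : cech_frac n x = 0 -> exists e, ktrans a e x = 0.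
Proof.
move=> x0.
have /choice[e eP] S : exists e, cech_mul a S ^+ e *: x S = 0.
  have /frac_eq[e] : Defs.frac (cech_mul a S) (x S) n = Defs.frac (cech_mul a S) 0 n.
    have := congr1 (fun y : cech a N => y S) x0.
    by rewrite /cech_frac => ->; rewrite frac0.
  by rewrite scaler0 => ?; exists (e + n)%N.
exists (\max_S e S)%N; apply/ffunP => S; rewrite !ffunE.
have le_e : (e S <= \max_S e S)%N by exact: leq_bigmax.
by rewrite -(subnK le_e) exprD -scalerA eP scaler0.
Qed.

Lemma cech_deg_frac i n x : kdeg i x -> cech_deg i (cech_frac n x).
Proof.
by move=> xi S Si; rewrite /cech_frac xi // frac0.
Qed.

(** A Čech cocycle z = x / a ^ n is zero, or the differential of y / a ^ n', if
    and only if the corresponding equation between x and y holds in the Koszul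
    complex once the exponents are large enough. *)
Lemma cech_acyclic i :
  (forall h : cech_cohomology a N i, h = 0) <-> acyclic a [set (0 : N)] i.
Proof.
rewrite cech_cohomology_eq0; split=> [H n x xi dx|H z zi dz].
  have {}dx : kdiff a n x = 0 by apply/ffunP => S; rewrite [LHS]dx ffunE.
  have Dx : cech_diff (cech_frac n x) = 0 by rewrite cech_diff_frac dx cech_frac0.
  have [/cech_frac_eq0[e ex]|[w [q [wq qi xw]]]] := H _ (cech_deg_frac n xi) Dx.
    exists e, 0; split=> S; first by rewrite ffunE.
    by rewrite linear0 subr0 ex ffunE.
  have [n' [y [yw /(_ _ wq) yq]]] := cech_frac_surj w.
  have xy : cech_frac (n + n')
      (ktrans a n' x - ktrans a n (kdiff a n' y)) = 0.
    rewrite cech_fracB cech_frac_ktrans addnC cech_frac_ktrans.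
    by rewrite -cech_diff_frac yw xw subrr.
  have [e] := cech_frac_eq0 xy.
  rewrite linearB /= !ktransD => exy; exists (n' + e)%N, (ktrans a (n + e) y); split.
    move=> S Si; apply: ktrans_eq0; apply: yq => Sq; apply: Si.
    by rewrite Sq.
  have -> : (n + (n' + e) = n' + (n + e))%N by rewrite addnCA.
  by rewrite -ktrans_kdiff exy => S; rewrite ffunE.
have [n [x [xz /(_ _ zi) xi]]] := cech_frac_surj z.
have [e ex] : exists e, ktrans a e (kdiff a n x) = 0.
  by apply: (@cech_frac_eq0 n); rewrite -cech_diff_frac xz.
have txi : kdeg i (ktrans a e x) by move=> S Si; apply: ktrans_eq0; exact: xi.
have dtx : kmod [set (0 : N)] (kdiff a (n + e) (ktrans a e x)).
  by rewrite -ktrans_kdiff ex => S; rewrite ffunE.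
have [e' [w [wi tw]]] := H _ _ txi dtx.
have {}tw : ktrans a e' (ktrans a e x) = kdiff a (n + e + e') w.
  by apply/eqP; rewrite -subr_eq0; apply/eqP/ffunP => S; rewrite [LHS]tw ffunE.
have zw : z = cech_diff (cech_frac (n + e + e') w).
  by rewrite cech_diff_frac -tw !cech_frac_ktrans xz.
case: i => [|q] in zi xi txi wi H *.
  left; rewrite zw (_ : w = 0) ?cech_frac0 ?linear0 //.
  by apply/ffunP => S; rewrite wi // ffunE.
right; exists (cech_frac (n + e + e') w), q; split=> //.
by apply: cech_deg_frac => S Sq; apply: wi => -[].
Qed.

Lemma depth_acyclic r : enat_le (Some r) (depth a N) <->
  forall i, (i < r)%N -> acyclic a [set (0 : N)] i.
Proof.
by rewrite depth_geP; split=> H i /H /cech_acyclic.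
Qed.

End CechKoszul.

(** * Regular sequences and depth *)

Section RegularSequences.
Context (R : comPzRingType) (N : lmodType R) (r : nat) (f : 'I_r -> R).

(** The submodule (f_1, ..., f_j) N. *)
Definition seq_submod (j : nat) : set N :=
  [set z | exists n : 'I_r -> N, z = \sum_(k < r | (k < j)%N) f k *: n k].

Lemma seq_submod_submod j : is_submod (seq_submod j).
Proof.
split=> [|c _ _ [n ->] [n' ->]].
  by exists (fun=> 0); rewrite big1 // => k _; rewrite scaler0.
exists (fun k => c *: n k + n' k); rewrite scaler_sumr -big_split /=.
by apply: eq_bigr => k _; rewrite scalerDr !scalerA mulrC.
Qed.

Lemma seq_submod0 : seq_submod 0 = [set 0].
Proof.
rewrite predeqE => z; split=> [[n ->]|->]; first by rewrite big1.
exact: submod0 (seq_submod_submod 0).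
Qed.

Lemma seq_submodS (i : 'I_r) : seq_submod i.+1 = add_mul (seq_submod i) (f i).
Proof.
rewrite predeqE => z; split=> [[n ->]|[y [n zn]]].
  exists (n i), n; rewrite (bigD1 i) //= addrAC subrr add0r.
  by apply: eq_bigl => k; rewrite ltnS ltn_neqAle andbC.
exists (fun k => if k == i then y else n k).
rewrite (bigD1 i) //= eqxx -[z](subrK (f i *: y)) zn addrC; congr (_ + _).
apply: eq_big => [k|k lt_ki]; first by rewrite ltnS ltn_neqAle andbC.
by case: eqVneq => // ki; rewrite ki ltnn in lt_ki *.
Qed.

Lemma span_seq_submod j :
  Defs.span [set y : N | exists2 b,
    ideal_gen [set f k | k in [set k : 'I_r | (k < j)%N]] b &
    exists n, y = b *: n] = seq_submod j.
Proof.
have JP := seq_submod_submod j.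
rewrite predeqE => z; split; last first.
  move=> [n ->]; apply: submod_sum => [|k lt_kj]; first exact: span_submod.
  apply: Defs.sub_span; exists (f k); last by exists (n k).
  by apply: (@Defs.sub_span _ R^o); exists k.
apply: span_min => // _ [b bf [n ->]].
suff: ideal_gen [set f k | k in [set k : 'I_r | (k < j)%N]] `<=`
    [set b : R^o | seq_submod j (b *: n)] by apply.
apply: (@span_min _ R^o) => [|_ [k /= lt_kj <-]].
  split=> [|c u v uJ vJ]; first by rewrite /= scale0r; exact: submod0.
  by rewrite /= scalerDl -scalerA; exact: JP.2.
exists (fun l => if l == k then n else 0); rewrite (bigD1 k) //= eqxx.
by rewrite big1 ?addr0 // => l /andP[_ /negPf->]; rewrite scaler0.
Qed.

Lemma regular_seqP : regular_seq N f <->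
  forall (i : 'I_r) z, seq_submod i (f i *: z) -> seq_submod i z.
Proof.
split=> H i z.
  rewrite -span_seq_submod => /quo_eq0 fz; apply/quo_eq0; apply: H.
  by rewrite -linearZ.
have [y <-] := quo_surj z; rewrite -linearZ => /quo_eq0.
by rewrite span_seq_submod => /H; rewrite -span_seq_submod => /quo_eq0.
Qed.

Context (s : nat) (a : 'I_s -> R).

(** Downward induction on j: the claim for N / (f_1, ..., f_j) N concerns the
    degrees below r - j, and so is empty for j = r. *)
Lemma acyclic_of_regular_seq : regular_seq N f ->
  (forall i, ideal_gen (range a) (f i)) ->
  forall i, (i < r)%N -> acyclic a [set (0 : N)] i.
Proof.
move=> /regular_seqP f_reg f_a.
suff H m j i : (j + m = r)%N -> (i < m)%N -> acyclic a (seq_submod j) i.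
  by rewrite -seq_submod0 => i; exact: H.
elim: m j i => // m IH j i jm lt_im.
have lt_jr : (j < r)%N by rewrite -jm addnS ltnS leq_addr.
apply: (@acyclic_of_add_mul _ _ _ _ _ (f (Ordinal lt_jr))) => //.
- exact: seq_submod_submod.
- exact: (f_reg (Ordinal lt_jr)).
move=> q qi; have := seq_submodS (Ordinal lt_jr) => /= <-.
by apply: IH; [rewrite addSnnS | rewrite -ltnS qi].
Qed.

(** By [acyclic_add_mul] each quotient by a new f_i costs one degree of
    vanishing.  Degree 0 is still available before each of the r steps, so the
    regularity of f_i is only to be shown under that assumption. *)
Lemma regular_seq_of_acyclic :
  (forall i, (i < r)%N -> acyclic a [set (0 : N)] i) ->
  (forall i : 'I_r, acyclic a (seq_submod i) 0 ->
    forall z, seq_submod i (f i *: z) -> seq_submod i z) ->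
  regular_seq N f.
Proof.
move=> Ha Hf; apply/regular_seqP => i; apply: (Hf).
suff H j q : (q + j < r)%N -> acyclic a (seq_submod j) q by apply: H; rewrite add0n.
elim: j q => [|j IH] q lt_qr.
  by rewrite seq_submod0; apply: Ha; rewrite addn0 in lt_qr.
have lt_jr : (j < r)%N by apply: leq_ltn_trans lt_qr; rewrite addnS leqW ?leq_addl.
have := seq_submodS (Ordinal lt_jr) => /= ->.
apply: acyclic_add_mul; first exact: seq_submod_submod.
- by apply: (Hf (Ordinal lt_jr)); exact: IH.
- by apply: IH; apply: leq_ltn_trans lt_qr; rewrite leq_add2l.
- by apply: IH; rewrite addSnnS.
Qed.

End RegularSequences.

Lemma regular_seq_iso (R : comPzRingType) (N N' : lmodType R)
    (u : {linear N -> N'}) (r : nat) (f : 'I_r -> R) :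
  bijective u -> regular_seq N' f -> regular_seq N f.
Proof.
move=> [v uK vK] /regular_seqP reg; apply/regular_seqP => i z [n zn].
have [|n' uzn] := reg i (u z).
  exists (u \o n); rewrite -linearZ zn linear_sum.
  by apply: eq_bigr => k _; rewrite [LHS]linearZ.
exists (v \o n'); apply: (can_inj uK); rewrite uzn linear_sum.
by apply: eq_bigr => k _; rewrite [RHS]linearZ /= vK.
Qed.

(** An element killed by all the a_k is a cocycle of degree 0, where there are
    no coboundaries and the transition maps are the identity. *)
Lemma acyclic0_torsion (R : comPzRingType) (N : lmodType R) (s : nat)
    (a : 'I_s -> R) (J : set N) z : is_submod J -> acyclic a J 0 ->
  (forall k, J (a k *: z)) -> J z.
Proof.
move=> JP /(_ 1%N [ffun S : {set 'I_s} => if S == finset.set0 then z else 0]) H az.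
have [||e [w [w0]]] := H.
- by move=> S S0; rewrite ffunE; case: eqP => // e; rewrite e cards0 in S0.
- move=> S; rewrite ffunE; apply: submod_sum => // k kS; rewrite ffunE.
  case: ifP => _; last by rewrite scaler0; exact: submod0.
  by rewrite -scalerA expr1; apply: submodZ.
move=> /(_ finset.set0); rewrite cochainB !ffunE eqxx big_set0 subr0.
by rewrite /cech_mul big_set0 expr1n scale1r.
Qed.

(** * Polynomial modules *)

Lemma malg_additive_ind (K : choiceType) (G : zmodType) (P : {malg G[K]} -> Prop) :
  P 0 -> (forall u v, P u -> P v -> P (u + v)) -> (forall c k, P << c *g k >>) ->
  forall g, P g.
Proof.
move=> P0 PD PU g; rewrite [g]monalgE.
by elim/big_rec: _ => // k x _; apply: PD.
Qed.

HB.lock Definition malgmod_scale (A : comPzRingType) (K : conomType)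
    (M : lmodType A) (g : malgring A K) (x : {malg M[K]}) : {malg M[K]} :=
  \sum_(k <- msupp g) \sum_(l <- msupp x) << g@_k *: x@_l *g mmul k l >>.

Section PolynomialModule.
Context (A : comPzRingType) (K : conomType) (M : lmodType A).

(** The module M[K] over the monoid algebra A[K]: a concrete copy of the
    tensor product of A[K] and M (see [tensor_malgmod_bij]), on which one can
    compute coefficient by coefficient. *)
Definition malgmod : Type := {malg M[K]}.
HB.instance Definition _ := GRing.Zmodule.on malgmod.
Implicit Types (g : malgring A K) (x : malgmod).

Lemma malgmod_scaleEw (d1 d2 : {fset K}) g x :
  (msupp g `<=` d1)%fset -> (msupp x `<=` d2)%fset ->
  malgmod_scale g x =
  \sum_(k <- d1) \sum_(l <- d2) << g@_k *: x@_l *g mmul k l >>.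
Proof.
move=> le1 le2; rewrite malgmod_scale.unlock (big_fset_incl _ le1) /=.
  apply/eq_bigr=> k _; apply/big_fset_incl => // l _ /mcoeff_outdom ->.
  by rewrite scaler0 monalgU0.
move=> k _ /mcoeff_outdom gk.
by rewrite big1 => // l _; rewrite gk scale0r monalgU0.
Qed.

Lemma malgmod_scaleUU c m (k l : K) :
  malgmod_scale (<< c *g k >> : malgring A K) (<< m *g l >> : malgmod) =
  << c *: m *g mmul k l >>.
Proof.
by rewrite (malgmod_scaleEw msuppU_le msuppU_le) !big_seq_fset1 !mcoeffUU.
Qed.

Fact malgmod_scaleDl x : {morph (@malgmod_scale A K M)^~ x : g g' / g + g'}.
Proof.
move=> g g'; pose d := (msupp (g + g') `|` msupp g `|` msupp g')%fset.
rewrite !(@malgmod_scaleEw d (msupp x)) ?fsubset_refl // -?big_split /=.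
- apply/eq_bigr=> k _; rewrite -big_split /=; apply/eq_bigr=> l _.
  by rewrite mcoeffD scalerDl monalgUD.
- by rewrite /d fsubsetUr.
- by rewrite /d -fsetUA fsetUCA fsubsetUl.
- by rewrite /d -fsetUA fsubsetUl.
Qed.

Fact malgmod_scaleDr : right_distributive (@malgmod_scale A K M) +%R.
Proof.
move=> g x x'; pose d := (msupp (x + x') `|` msupp x `|` msupp x')%fset.
rewrite !(@malgmod_scaleEw (msupp g) d) ?fsubset_refl // -?big_split /=.
- apply/eq_bigr=> k _; rewrite -big_split /=; apply/eq_bigr=> l _.
  by rewrite mcoeffD scalerDr monalgUD.
- by rewrite /d fsubsetUr.
- by rewrite /d -fsetUA fsetUCA fsubsetUl.
- by rewrite /d -fsetUA fsubsetUl.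
Qed.

Lemma malgmod_scale0l x : malgmod_scale 0 x = 0.
Proof. by rewrite malgmod_scale.unlock msupp0 big_seq_fset0. Qed.

Lemma malgmod_scale0r g : malgmod_scale g (0 : malgmod) = 0.
Proof.
by rewrite malgmod_scale.unlock big1 // => k _; rewrite msupp0 big_seq_fset0.
Qed.

Fact malgmod_scaleA g g' x :
  malgmod_scale g (malgmod_scale g' x) = malgmod_scale (g * g') x.
Proof.
elim/malg_ind: g => [|u v IHu IHv|c k].
- by rewrite mul0r !malgmod_scale0l.
- by rewrite mulrDl !malgmod_scaleDl IHu IHv.
elim/malg_ind: g' => [|u v IHu IHv|c' k'].
- by rewrite mulr0 malgmod_scale0l malgmod_scale0r.
- by rewrite mulrDr !malgmod_scaleDl malgmod_scaleDr IHu IHv.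
elim/malg_additive_ind: x => [|u v IHu IHv|m l].
- by rewrite !malgmod_scale0r.
- by rewrite !malgmod_scaleDr IHu IHv.
rewrite !malgmod_scaleUU [_ * _ in RHS]malg_mulUU malgmod_scaleUU.
by rewrite scalerA mulmA.
Qed.

Fact malgmod_scale1 : left_id 1 (@malgmod_scale A K M).
Proof.
move=> x; elim/malg_additive_ind: x => [|u v IHu IHv|m l].
- exact: malgmod_scale0r.
- by rewrite malgmod_scaleDr IHu IHv.
by rewrite malgmod_scaleUU scale1r mul1m.
Qed.

HB.instance Definition _ := GRing.Zmodule_isLmodule.Build (malgring A K) malgmod
  malgmod_scaleA malgmod_scale1 malgmod_scaleDr malgmod_scaleDl.

Lemma malgmodUU c m (k l : K) :
  (<< c *g k >> : malgring A K) *: (<< m *g l >> : malgmod) =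
  << c *: m *g mmul k l >>.
Proof. exact: malgmod_scaleUU. Qed.

Lemma malgmod_coefC c x k : (malgrC K c *: x)@_k = c *: x@_k.
Proof.
elim/malg_additive_ind: x => [|u v IHu IHv|m l].
- by rewrite scaler0 !mcoeff0 scaler0.
- by rewrite scalerDr !mcoeffD scalerDr IHu IHv.
by rewrite malgmodUU mul1m !mcoeffU scalerMnr.
Qed.

End PolynomialModule.

Section Pure.
Context (A B : comPzRingType) (phi : {rmorphism A -> B}) (M : lmodType A).

Lemma pure0l (m : M) : pure phi 0 m = 0.
Proof. exact: scale0r. Qed.

Lemma pureDl b c (m : M) : pure phi (b + c) m = pure phi b m + pure phi c m.
Proof. exact: scalerDl. Qed.

Lemma pureDr b (m n : M) : pure phi b (m + n) = pure phi b m + pure phi b n.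
Proof. by rewrite pureE pure1D scalerDr -!pureE. Qed.

Lemma pure0r b : pure phi b (0 : M) = 0.
Proof. by apply: (addrI (pure phi b 0)); rewrite -pureDr !addr0. Qed.

End Pure.

Lemma tensor_ind (A B : comPzRingType) (phi : {rmorphism A -> B})
    (M : lmodType A) (P : tensor phi M -> Prop) :
  P 0 -> (forall u v, P u -> P v -> P (u + v)) ->
  (forall b m, P (pure phi b m)) -> forall x, P x.
Proof.
move=> P0 PD PU x; have [g <-] := quo_surj x.
elim/malg_additive_ind: g => [|u v IHu IHv|b m]; first by rewrite linear0.
  by rewrite quoD; exact: PD.
by rewrite freebE linearZ; exact: PU.
Qed.

Section TensorMalgmod.
Context (A : comPzRingType) (K : conomType).
Local Notation phi := (@malgrC A K).

Section Module.
Context (M : lmodType A).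

Definition tensor_malgmod : tensor phi M -> malgmod K M :=
  tensor_lift (fun m => << m *g mone >> : malgmod K M).

Let constD : {morph (fun m : M => << m *g mone >> : malgmod K M) : m n / m + n}.
Proof. by move=> m n; rewrite monalgUD. Qed.
Let constZ a (m : M) :
  (<< a *: m *g mone >> : malgmod K M) = phi a *: (<< m *g mone >> : malgmod K M).
Proof. by rewrite malgmodUU mul1m. Qed.

Fact tensor_malgmod_is_linear : linear tensor_malgmod.
Proof. exact: tensor_lift_linear constD constZ. Qed.
HB.instance Definition _ := GRing.isLinear.Build (malgring A K) (tensor phi M)
  (malgmod K M) *:%R tensor_malgmod tensor_malgmod_is_linear.

Lemma tensor_malgmodD : {morph tensor_malgmod : x y / x + y}.
Proof. exact: linearD. Qed.

Lemma tensor_malgmod0 : tensor_malgmod 0 = 0.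
Proof. exact: linear0. Qed.

Lemma tensor_malgmod_pure c k m :
  tensor_malgmod (pure phi << c *g k >> m) = << c *: m *g k >>.
Proof.
rewrite /tensor_malgmod (tensor_liftP constD constZ) malgmodUU.
by rewrite mulm1.
Qed.

Definition malgmod_tensor (x : malgmod K M) : tensor phi M :=
  \sum_(k <- msupp x) pure phi << 1 *g k >> x@_k.

Lemma malgmod_tensorEw (d : {fset K}) x : (msupp x `<=` d)%fset ->
  malgmod_tensor x = \sum_(k <- d) pure phi << 1 *g k >> x@_k.
Proof.
move=> le; rewrite /malgmod_tensor (big_fset_incl _ le) // => k _.
by move=> /mcoeff_outdom ->; rewrite pure0r.
Qed.

Lemma malgmod_tensorD : {morph malgmod_tensor : x y / x + y}.
Proof.
move=> x y; pose d := (msupp (x + y) `|` msupp x `|` msupp y)%fset.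
rewrite !(@malgmod_tensorEw d) -?big_split /=.
- by apply: eq_bigr => k _; rewrite mcoeffD pureDr.
- by rewrite /d fsubsetUr.
- by rewrite /d -fsetUA fsetUCA fsubsetUl.
- by rewrite /d -fsetUA fsubsetUl.
Qed.

Lemma malgmod_tensorU m k : malgmod_tensor << m *g k >> = pure phi << 1 *g k >> m.
Proof. by rewrite (malgmod_tensorEw msuppU_le) big_seq_fset1 mcoeffUU. Qed.

Lemma malgmod_tensor0 : malgmod_tensor 0 = 0.
Proof. by rewrite /malgmod_tensor msupp0 big_seq_fset0. Qed.

Lemma malgmod_tensorK : cancel malgmod_tensor tensor_malgmod.
Proof.
move=> x; elim/malg_additive_ind: x => [|u v IHu IHv|m k].
- by rewrite malgmod_tensor0 tensor_malgmod0.
- by rewrite malgmod_tensorD tensor_malgmodD; exact: (f_equal2 +%R IHu IHv).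
by rewrite malgmod_tensorU tensor_malgmod_pure scale1r.
Qed.

Lemma tensor_malgmodK : cancel tensor_malgmod malgmod_tensor.
Proof.
move=> x; elim/tensor_ind: x => [|u v IHu IHv|b m].
- by rewrite tensor_malgmod0 malgmod_tensor0.
- by rewrite tensor_malgmodD malgmod_tensorD; exact: (f_equal2 +%R IHu IHv).
elim/malg_ind: b => [|u v IHu IHv|c k].
- by rewrite pure0l tensor_malgmod0 malgmod_tensor0.
- by rewrite pureDl tensor_malgmodD malgmod_tensorD; exact: (f_equal2 +%R IHu IHv).
rewrite tensor_malgmod_pure malgmod_tensorU pureE pure1Z scalerA [RHS]pureE.
by rewrite [_ * _]malg_mulUU mul1r mulm1.
Qed.

Lemma tensor_malgmod_bij : bijective tensor_malgmod.
Proof. exact: Bijective tensor_malgmodK malgmod_tensorK. Qed.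

End Module.

Lemma tensor_malgmod_map (M N : lmodType A) (u : {linear M -> N})
    (x : tensor phi M) k :
  (tensor_malgmod (tensor_map u x))@_k = u (tensor_malgmod x)@_k.
Proof.
have map0 : tensor_map u (0 : tensor phi M) = 0 by exact: linear0.
have mapD (v w : tensor phi M) :
  tensor_map u (v + w) = tensor_map u v + tensor_map u w by exact: linearD.
pose P y := (tensor_malgmod (tensor_map u y))@_k = u (tensor_malgmod y)@_k.
have P0 : P 0 by rewrite /P map0 !tensor_malgmod0 !mcoeff0 linear0.
have PD v w : P v -> P w -> P (v + w).
  rewrite /P => Pv Pw; rewrite mapD !tensor_malgmodD !mcoeffD (linearD u) /=.
  exact: (f_equal2 +%R Pv Pw).
elim/tensor_ind: x => [||b m] //; rewrite -/(P _).
elim/malg_ind: b => [|v w Pv Pw|c l]; first by rewrite pure0l.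
  by rewrite pureDl; exact: PD.
rewrite /P tensor_map_pure.
rewrite !tensor_malgmod_pure !mcoeffU [RHS]raddfMn.
by congr (_ *+ _); exact: (esym (linearZ_LR u c m)).
Qed.

(** By [tensor_malgmod_map], exactness after extension of scalars is exactness
    at each coefficient. *)
Lemma malgrC_faithfully_flat : faithfully_flat phi.
Proof.
move=> N1 N2 N3 u v; split=> uv y; split.
- move=> vy.
  have /choice[x xP] k : exists x, u x = (tensor_malgmod y)@_k.
    by apply/uv; rewrite -tensor_malgmod_map vy linear0 mcoeff0.
  pose z : malgmod K N1 := [malg k in msupp (tensor_malgmod y) => x k].
  exists (malgmod_tensor z); apply: (can_inj (@tensor_malgmodK _)).
  apply/malgP => k; rewrite tensor_malgmod_map malgmod_tensorK mcoeffE.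
  case: ifPn => [_|/mcoeff_outdom ->]; first exact: xP.
  exact: linear0.
- move=> [x <-]; apply: (can_inj (@tensor_malgmodK _)); apply/malgP => k.
  rewrite !tensor_malgmod_map linear0 mcoeff0; apply/uv.
  by exists (tensor_malgmod x)@_k.
- move=> vy; have : tensor_map v (pure phi 1 y) = 0.
    by rewrite tensor_map_pure vy pure0r.
  move=> /uv[x /(congr1 (fun z => (tensor_malgmod z)@_mone))].
  rewrite tensor_malgmod_map tensor_malgmod_pure mcoeffUU scale1r.
  by exists (tensor_malgmod x)@_mone.
move=> [x <-]; have : tensor_map v (pure phi 1 (u x)) = 0.
  by apply/uv; exists (pure phi 1 x); exact: tensor_map_pure.
rewrite tensor_map_pure => /(congr1 (fun z => (tensor_malgmod z)@_mone)).
by rewrite tensor_malgmod_pure mcoeffUU scale1r linear0 mcoeff0.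
Qed.

End TensorMalgmod.

(** * Acyclicity of polynomial modules *)

Section AcyclicMalgmod.
Context (A : comPzRingType) (K : conomType) (M : lmodType A).
Context (s : nat) (a : 'I_s -> A).
Local Notation phi := (@malgrC A K).
Implicit Types x : cochain s (malgmod K M).

Definition coef_cochain (k : K) x : cochain s M := [ffun S => (x S)@_k].

Lemma coef_cochainE k x S : coef_cochain k x S = (x S)@_k.
Proof. by rewrite ffunE. Qed.

Lemma coef_kdiff k n x :
  coef_cochain k (kdiff (phi \o a) n x) = kdiff a n (coef_cochain k x).
Proof.
apply/ffunP => S; rewrite !ffunE raddf_sum; apply: eq_bigr => l _.
rewrite ffunE -malgmod_coefC.
suff -> : phi (ksign A l S * a l ^+ n) = ksign _ l S * phi (a l) ^+ n by [].
by rewrite rmorphM rmorphXn /= /ksign rmorphXn /= rmorphN1.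
Qed.

Lemma coef_ktrans k e x :
  coef_cochain k (ktrans (phi \o a) e x) = ktrans a e (coef_cochain k x).
Proof.
apply/ffunP => S; rewrite !ffunE -malgmod_coefC.
suff -> : phi (cech_mul a S ^+ e) = cech_mul (phi \o a) S ^+ e by [].
by rewrite rmorphXn /= /cech_mul rmorph_prod.
Qed.

(** A cochain with values in M[K] has finitely many nonzero coefficients, which
    are cochains with values in M; so the increments of the exponent which they
    require have an upper bound. *)
Lemma acyclic_malgmod i :
  acyclic a [set (0 : M)] i -> acyclic (phi \o a) [set (0 : malgmod K M)] i.
Proof.
move=> H n x xi dx.
have {}dx : kdiff (phi \o a) n x = 0 by apply/ffunP => S; rewrite [LHS]dx ffunE.
pose d := flatten [seq enum_fset (msupp (x T)) | T : {set 'I_s}].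
have x_out k : k \notin d -> coef_cochain k x = 0.
  move=> kd; apply/ffunP => S; rewrite !ffunE; apply: mcoeff_outdom.
  apply: contra kd => kS; apply/flattenP; exists (enum_fset (msupp (x S))) => //.
  by apply/mapP; exists S; rewrite ?mem_enum.
have /choice[e eP] k : exists e, exists w : cochain s M, kdeg_pred i w /\
    ktrans a e (coef_cochain k x) = kdiff a (n + e) w.
  have [||e [w [wi xw]]] := H n (coef_cochain k x).
  - by move=> S Si; rewrite ffunE xi // mcoeff0.
  - by rewrite -coef_kdiff dx => S; rewrite !ffunE mcoeff0.
  exists e, w; split=> //; apply/eqP; rewrite -subr_eq0; apply/eqP/ffunP => S.
  by rewrite [LHS]xw ffunE.
pose E := (\max_(k <- d) e k)%N.
have /choice[w wP] k : exists w : cochain s M, kdeg_pred i w /\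
    ((k \notin d -> w = 0) /\
     ktrans a E (coef_cochain k x) = kdiff a (n + E) w).
  have [kd|kd] := boolP (k \in d); last first.
    exists 0; split=> [S _|]; first by rewrite ffunE.
    by rewrite x_out // !linear0.
  have [w [wi xw]] := eP k; exists (ktrans a (E - e k) w).
  have le_eE : (e k <= E)%N by exact: leq_bigmax_seq.
  split=> [S Si|]; first by apply: ktrans_eq0; exact: wi.
  by split=> //; rewrite -[in LHS](subnKC le_eE) -ktransD xw ktrans_kdiff -addnA subnKC.
pose W : cochain s (malgmod K M) :=
  [ffun S => [malg k in seq_fset tt d => w k S]].
have WE k : coef_cochain k W = w k.
  apply/ffunP => S; rewrite !ffunE mcoeffE seq_fsetE; case: ifPn => // kd.
  by rewrite (wP k).2.1 // ffunE.
exists E, W; split=> [S Si|].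
  rewrite ffunE; apply/malgP => k; rewrite mcoeffE mcoeff0.
  by case: ifP => // _; rewrite (wP k).1.
suff -> : ktrans (phi \o a) E x = kdiff (phi \o a) (n + E) W.
  by rewrite subrr => S; rewrite ffunE.
apply/ffunP => S; apply/malgP => k.
have := congr1 (fun y : cochain s M => y S) (wP k).2.2.
by rewrite -WE -coef_kdiff -coef_ktrans !coef_cochainE.
Qed.

End AcyclicMalgmod.

(** * The generic element of an ideal *)

(** The polynomial in t with the coefficients l, evaluated by the Horner
    scheme. *)
Definition generic_elt (R : comPzRingType) (l : seq R) (t : R) : R :=
  foldr (fun c p => c + t * p) 0 l.

Lemma generic_elt_ideal (R : comPzRingType) (X : set R) (l : seq R) (t : R) :
  (forall c, c \in l -> X c) -> ideal_gen X (generic_elt l t).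
Proof.
move=> lX; have XP := span_submod (X : set R^o).
elim: l lX => [|c l IH] lX /=; first exact: submod0 XP.
apply: (submodD XP).
  by apply: (@Defs.sub_span _ R^o); apply: lX; rewrite mem_head.
by apply: (submodZ XP); apply: IH => b bl; apply: lX; rewrite inE bl orbT.
Qed.

(** McCoy's theorem, for a module N on which t has a locally nilpotent left
    inverse delta (on polynomials in t: divide by t and drop the constant
    term). *)
Section McCoy.
Context (R : comPzRingType) (N : lmodType R) (J : set N) (t : R).
Context (delta : {additive N -> N}).
Hypothesis JP : is_submod J.
Hypothesis deltaJ : forall z, J z -> J (delta z).
Hypothesis deltaK : forall z, delta (t *: z) = z.
Hypothesis delta_nilp : forall z, exists n, iter n delta z = 0.

(** Applying the operator 1 - t delta to (c + t p) z leaves c z - t z', where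
    z' = c delta z.  So c z and t z' are congruent modulo J, hence c + t p kills
    z' as well, and fewer iterates of delta kill z' than z. *)
Lemma generic_elt_nilp c p z :
  (forall y, delta (c *: y) = c *: delta y) ->
  J ((c + t * p) *: z) -> exists n, J (c ^+ n *: z).
Proof.
move=> deltaC fz; have [n zn] := delta_nilp z; exists n.
elim: n z zn fz => [|n IH] z zn fz.
  by move: zn => /= ->; rewrite scaler0; exact: submod0.
pose z' := c *: delta z.
have cz : J (c *: z - t *: z').
  have -> : c *: z - t *: z' =
      (c + t * p) *: z - t *: delta ((c + t * p) *: z).
    rewrite !scalerDl -!scalerA raddfD /= deltaC deltaK scalerDr opprD addrACA.
    by rewrite subrr addr0.
  by apply: submodB => //; apply: submodZ => //; exact: deltaJ.
have z'n : iter n delta z' = 0.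
  have iterC m y : iter m delta (c *: y) = c *: iter m delta y.
    by elim: m => //= m ->; exact: deltaC.
  by rewrite iterC -iterSr zn scaler0.
have fz' : J ((c + t * p) *: z').
  rewrite -[_ *: z']deltaK; apply: deltaJ; rewrite scalerA mulrC -scalerA.
  have -> : (c + t * p) *: (t *: z') =
      c *: ((c + t * p) *: z) - (c + t * p) *: (c *: z - t *: z').
    by rewrite scalerBr !scalerA (mulrC c) opprB addrCA subrr addr0.
  by apply: submodB => //; exact: submodZ.
have := IH _ z'n fz' => cnz'.
have -> : c ^+ n.+1 *: z = c ^+ n *: (c *: z - t *: z') + t *: (c ^+ n *: z').
  by rewrite scalerBr !scalerA -exprSr (mulrC t) subrK.
by apply: submodD => //; exact: submodZ.
Qed.

(** The coefficients are treated one after the other: c is nilpotent on z by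
    [generic_elt_nilp], so it kills some nonzero multiple y of z; then t, hence
    also delta, reduces the claim for y to the remaining coefficients. *)
Lemma generic_elt_torsion (l : seq R) z :
  (forall c, c \in l -> forall y, delta (c *: y) = c *: delta y) ->
  J (generic_elt l t *: z) -> ~ J z ->
  exists b, ~ J (b *: z) /\ forall c, c \in l -> J (c *: (b *: z)).
Proof.
elim: l z => [|c l IH] z deltaC fz Jz; first by exists 1; rewrite scale1r.
have deltaC1 : forall y, delta (c *: y) = c *: delta y.
  by apply: deltaC; rewrite mem_head.
have exn : exists n, `[< J (c ^+ n *: z) >].
  by have [n cnz] := generic_elt_nilp deltaC1 fz; exists n; exact/asboolP.
(* y is the last nonzero multiple of z by a power of c. *)
case: (ex_minnP exn) => -[|n] /asboolP cz nmin; first by rewrite scale1r in cz.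
pose y := c ^+ n *: z.
have Jy : ~ J y by move=> /asboolP/nmin; rewrite ltnn.
have cy : J (c *: y) by rewrite scalerA -exprS.
have fy : J (generic_elt l t *: y).
  rewrite -[_ *: y]deltaK; apply: deltaJ.
  have -> : t *: (generic_elt l t *: y) =
      c ^+ n *: (generic_elt (c :: l) t *: z) - c *: y.
    rewrite /= [c ^+ n *: _]scalerA (mulrC (c ^+ n)) -scalerA -/y.
    rewrite scalerDl addrAC subrr add0r.
    by rewrite scalerA.
  by apply: submodB => //; exact: submodZ.
have [|b [by0 byl]] := IH y _ fy Jy.
  by move=> b bl; apply: deltaC; rewrite inE bl orbT.
exists (b * c ^+ n); rewrite -scalerA; split=> // d; rewrite inE => /predU1P[->|].
  by rewrite scalerA mulrC -scalerA; exact: submodZ.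
exact: byl.
Qed.

Lemma generic_elt_nonzerodivisor (l : seq R) :
  (forall c, c \in l -> forall y, delta (c *: y) = c *: delta y) ->
  (forall z, (forall c, c \in l -> J (c *: z)) -> J z) ->
  forall z, J (generic_elt l t *: z) -> J z.
Proof.
move=> deltaC tor z fz; apply: contrapT => Jz.
by have [b [bz bl]] := generic_elt_torsion deltaC fz Jz; apply: bz; exact: tor.
Qed.

End McCoy.

(** * A regular sequence on the polynomial module *)

Section DivideByVariable.
Context (A : comPzRingType) (E : choiceType) (M : lmodType A) (i : E).
Local Notation K := {cmonom E}.
Implicit Types (x : malgmod K M) (m : K).

Definition variable (j : E) : polyring A E := << 1 *g ucm j >>.

(** Division by the variable of index i, dropping the monomials in which it does
    not occur: the map delta of [generic_elt_nonzerodivisor]. *)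
Definition divX x : malgmod K M :=
  [malg m in [fset divcm m (ucm i) | m in msupp x]%fset => x@_(mmul m (ucm i))].

Lemma divX_coef x m : (divX x)@_m = x@_(mmul m (ucm i)).
Proof.
rewrite mcoeffE; case: ifPn => // /imfsetP m_out; rewrite mcoeff_outdom //.
apply/negP => mx; apply: m_out; exists (mmul m (ucm i)) => //.
by apply/eqP/cmP => j; rewrite divcmE cmM addnK.
Qed.

Fact divX_is_zmod_morphism : zmod_morphism divX.
Proof. by move=> x y; apply/malgP => m; rewrite mcoeffB !divX_coef mcoeffB. Qed.
HB.instance Definition _ :=
  GRing.isZmodMorphism.Build (malgmod K M) (malgmod K M) divX
    divX_is_zmod_morphism.

Lemma divXU (v : M) m : divX << v *g m >> =
  if m i == 0%N then 0 else << v *g divcm m (ucm i) >>.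
Proof.
apply/malgP => m'; rewrite divX_coef mcoeffU.
have [mi|mi] := eqVneq (m i) 0%N.
  rewrite mcoeff0 (_ : m == _ = false) //; apply/negP => /cmP/(_ i).
  by rewrite cmM cmUU mi addn1.
rewrite mcoeffU; congr (_ *+ _); congr nat_of_bool; apply/cmP/cmP => H j.
  by rewrite divcmE H cmM addnK.
rewrite cmM -H divcmE cmU subnK //; case: eqVneq => // <-.
by rewrite lt0n.
Qed.

Lemma divXC c x : divX (malgrC K c *: x) = malgrC K c *: divX x.
Proof. by apply/malgP => m; rewrite divX_coef !malgmod_coefC divX_coef. Qed.

Lemma divX_variable x : divX (variable i *: x) = x.
Proof.
elim/malg_additive_ind: x => [|u v IHu IHv|c m].
- by rewrite scaler0 raddf0.
- by rewrite scalerDr raddfD; exact: (f_equal2 +%R IHu IHv).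
rewrite /variable malgmodUU divXU scale1r cmM cmUU /=.
suff -> : divcm (mmul (ucm i) m) (ucm i) = m by [].
by apply/eqP/cmP => j; rewrite divcmE cmM addKn.
Qed.

Lemma divX_variable_neq j x : j != i ->
  divX (variable j *: x) = variable j *: divX x.
Proof.
move=> ji; elim/malg_additive_ind: x => [|u v IHu IHv|c m].
- by rewrite scaler0 raddf0 scaler0.
- by rewrite scalerDr !raddfD; exact: (f_equal2 +%R IHu IHv).
rewrite /variable malgmodUU [LHS]divXU [divX _]divXU scale1r.
rewrite cmM cmU (negPf ji) add0n.
have [mi|mi] := eqVneq (m i) 0%N; first by rewrite scaler0.
rewrite [RHS]malgmodUU scale1r.
suff -> : divcm (mmul (ucm j) m) (ucm i) = mmul (ucm j) (divcm m (ucm i)) by [].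
apply/eqP/cmP => k; rewrite divcmE !cmM divcmE addnBA // cmU.
by case: eqVneq => // <-; rewrite lt0n.
Qed.

Lemma divX_nilp x : exists n, iter n divX x = 0.
Proof.
pose n := (\max_(m <- enum_fset (msupp x)) (m i).+1)%N; exists n.
have : forall m, (n <= m i)%N -> x@_m = 0.
  move=> m le_nm; apply: mcoeff_outdom; apply/negP => mx.
  have := @leq_bigmax_seq _ (enum_fset (msupp x)) xpredT
    (fun m : K => (m i).+1) m mx isT.
  by move=> /leq_trans/(_ le_nm); rewrite ltnn.
elim: n (x) => [|n IH] y y0; first by apply/malgP => m; rewrite y0 ?mcoeff0.
rewrite iterSr; apply: IH => m le_nm; rewrite divX_coef y0 //.
by rewrite cmM cmUU addn1.
Qed.

End DivideByVariable.

Section GenericSequence.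
Context (A : comPzRingType) (M : lmodType A) (r s : nat) (a : 'I_s -> A).
Local Notation K := {cmonom 'I_r}.
Local Notation phi := (polyringC A 'I_r).

Definition coefs : seq (polyring A 'I_r) := [seq phi (a k) | k : 'I_s].

(** Each element has a variable of its own, so that the submodule generated by
    the earlier ones is stable under the division by this variable. *)
Definition generic_seq (j : 'I_r) : polyring A 'I_r :=
  generic_elt coefs (variable A j).

Lemma divX_coefs (i : 'I_r) c (x : malgmod K M) : c \in coefs ->
  divX i (c *: x) = c *: divX i x.
Proof. by move=> /mapP[k _ ->]; exact: divXC. Qed.

Lemma divX_generic_seq (i j : 'I_r) (x : malgmod K M) : j != i ->
  divX i (generic_seq j *: x) = generic_seq j *: divX i x.
Proof.
move=> ji; rewrite /generic_seq.
elim: coefs (@divX_coefs i) x => [|c l IH] H x /=; first by rewrite !scale0r raddf0.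
rewrite !scalerDl -!scalerA raddfD /= divX_variable_neq // IH => [|b y bl].
  by rewrite H // mem_head.
by apply: H; rewrite inE bl orbT.
Qed.

Lemma generic_seq_regular :
  (forall i, (i < r)%N -> acyclic a [set (0 : M)] i) ->
  regular_seq (malgmod K M) generic_seq.
Proof.
move=> Ha; apply: (@regular_seq_of_acyclic _ _ _ _ _ (phi \o a)).
  by move=> i lt_ir; apply: acyclic_malgmod; exact: Ha.
move=> i Hi; have JP := seq_submod_submod (malgmod K M) generic_seq i.
apply: (@generic_elt_nonzerodivisor _ _ _ _ (divX i)) => //.
- move=> _ [n ->]; exists (fun k => divX i (n k)); rewrite raddf_sum.
  apply: eq_bigr => k lt_ki; apply: divX_generic_seq.
  by apply: contraTneq lt_ki => ->; rewrite ltnn.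
- exact: divX_variable.
- exact: divX_nilp.
- by move=> c cl y; exact: divX_coefs.
move=> z zJ; apply: acyclic0_torsion Hi _ => // k; apply: zJ.
by apply/mapP; exists k; rewrite ?mem_enum.
Qed.

End GenericSequence.

(** * Descent along a faithfully flat extension *)

Section LineMap.
Context (A : pzRingType) (Q : lmodType A) (q : Q).

Definition line_map (c : A^o) : Q := (c : A) *: q.

Fact line_map_is_linear : linear line_map.
Proof. by move=> c u v; rewrite /line_map scalerDl scalerA. Qed.
HB.instance Definition _ :=
  GRing.isLinear.Build A A^o Q *:%R line_map line_map_is_linear.

End LineMap.

Section PureCochain.
Context (A B : comPzRingType) (phi : {rmorphism A -> B}) (M : lmodType A).
Context (s : nat) (a : 'I_s -> A).

Definition single (S : {set 'I_s}) (m : M) : cochain s M :=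
  [ffun T => if T == S then m else 0].

Fact single_is_linear S : linear (single S).
Proof.
move=> c m n; apply/ffunP => T; rewrite !ffunE.
by case: ifP => // _; rewrite scaler0 addr0.
Qed.
HB.instance Definition _ S :=
  GRing.isLinear.Build A M (cochain s M) *:%R (single S) (single_is_linear S).

Lemma sum_single (x : cochain s M) : x = \sum_S single S (x S).
Proof.
apply/ffunP => S; rewrite sum_ffunE (bigD1 S) //= ffunE eqxx big1 ?addr0 // => T.
by rewrite ffunE eq_sym => /negPf ->.
Qed.

Definition pure_cochain (x : cochain s M) : cochain s (tensor phi M) :=
  [ffun S => pure phi 1 (x S)].

Lemma kdiff_pure_cochain n x :
  kdiff (phi \o a) n (pure_cochain x) = pure_cochain (kdiff a n x).
Proof.
apply/ffunP => S; rewrite !ffunE.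
rewrite (big_morph _ (pure1D phi (M := M)) (pure0r phi M 1)).
apply: eq_bigr => k _; rewrite ffunE pure1Z rmorphM rmorphXn /=.
by rewrite /ksign rmorphXn /= rmorphN1.
Qed.

Lemma ktrans_pure_cochain e x :
  ktrans (phi \o a) e (pure_cochain x) = pure_cochain (ktrans a e x).
Proof.
apply/ffunP => S; rewrite !ffunE pure1Z rmorphXn /=.
by rewrite /cech_mul rmorph_prod.
Qed.

(** A cochain is the sum of its components, and each component is a sum of pure
    tensors. *)
Lemma pure_cochain_ind i (P : cochain s (tensor phi M) -> Prop) :
  P 0 -> (forall u v, P u -> P v -> P (u + v)) ->
  (forall b x, kdeg_pred i x -> P (b *: pure_cochain x)) ->
  forall w, kdeg_pred i w -> P w.
Proof.
move=> P0 PD PU w wi.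
pose sing S z : cochain s (tensor phi M) := [ffun T => if T == S then z else 0].
have -> : w = \sum_S sing S (w S).
  apply/ffunP => S; rewrite sum_ffunE (bigD1 S) //= ffunE eqxx big1 ?addr0 // => T.
  by rewrite ffunE eq_sym => /negPf ->.
have sing0 S : sing S 0 = 0 by apply/ffunP => T; rewrite !ffunE; case: ifP.
elim/big_ind: _ => // S _.
have [Si|Si] := eqVneq #|S|.+1 i; last first.
  by rewrite wi ?sing0 //; exact/eqP.
elim/tensor_ind: (w S) => [|y z Py Pz|b m]; first by rewrite sing0.
  have -> : sing S (y + z) = sing S y + sing S z.
    by apply/ffunP => T; rewrite !ffunE; case: ifP; rewrite ?addr0.
  exact: PD.
have -> : sing S (pure phi b m) = b *: pure_cochain (single S m).
  apply/ffunP => T; rewrite !ffunE; case: ifP => _; first exact: pureE.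
  by rewrite pure0r scaler0.
apply: PU => T; rewrite ffunE; case: eqVneq => // ->.
by rewrite Si.
Qed.

Section Push.
Context (Q : lmodType A) (q : {linear cochain s M -> Q}).

(** The scalar extension of q, read on the cochains with values in the scalar
    extension of M: the index set is finite, so these are the scalar extension
    of the cochains with values in M. *)
Definition push (w : cochain s (tensor phi M)) : tensor phi Q :=
  \sum_S tensor_map (q \o single S) (w S).

Fact push_is_linear : linear push.
Proof.
move=> b u v; rewrite /push scaler_sumr -big_split /=; apply: eq_bigr => S _.
by rewrite !ffunE; exact: linearP.
Qed.
HB.instance Definition _ := GRing.isLinear.Build B (cochain s (tensor phi M))
  (tensor phi Q) *:%R push push_is_linear.

Lemma push_pure x : push (pure_cochain x) = pure phi 1 (q x).
Proof.
rewrite [in RHS](sum_single x) linear_sum.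
rewrite (big_morph _ (pure1D phi (M := Q)) (pure0r phi Q 1)).
by apply: eq_bigr => S _; rewrite ffunE; exact: tensor_map_pure.
Qed.

End Push.
End PureCochain.

Section Descent.
Context (A B : comPzRingType) (phi : {rmorphism A -> B}).
Hypothesis phi_ff : faithfully_flat phi.

(** The maps A -> Q, which sends 1 to q, and the identity Q -> Q form an exact
    sequence exactly when q = 0. *)
Lemma faithfully_flat_pure_eq0 (Q : lmodType A) (q : Q) :
  pure phi 1 q = 0 -> q = 0.
Proof.
move=> q0.
pose u : {linear A^o -> Q} := line_map q.
pose v : {linear Q -> Q} := idfun.
have vE (y : tensor phi Q) : tensor_map v y = y.
  elim/tensor_ind: y => [|y y' IHy IHy'|b m]; first exact: linear0.
    by rewrite [LHS]linearD; exact: (f_equal2 +%R IHy IHy').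
  by rewrite tensor_map_pure.
have uE (x : tensor phi A^o) : tensor_map u x = 0.
  elim/tensor_ind: x => [|x x' IHx IHx'|b c]; first exact: linear0.
    by rewrite [LHS]linearD -[RHS]addr0; exact: (f_equal2 +%R IHx IHx').
  by rewrite tensor_map_pure pureE /= pure1Z q0 !scaler0.
have uv : exact_seq u v.
  apply/phi_ff => y; split=> [vy|[x <-]]; last exact: etrans (vE _) (uE x).
  by exists 0; apply: etrans (uE 0) _; rewrite -vy; exact: vE.
have /uv vq : exists x, u x = u 1 by exists 1.
by rewrite -(scale1r q); exact: vq.
Qed.

Context (M : lmodType A) (s : nat) (a : 'I_s -> A).

(** With Q the quotient of the cochains by the coboundaries of the exponents
    n + e, a cochain x is a coboundary if its class q in Q is zero, and by
    [faithfully_flat_pure_eq0] this can be tested after extension of scalars. *)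
Lemma acyclic_descent i :
  acyclic (phi \o a) [set (0 : tensor phi M)] i -> acyclic a [set (0 : M)] i.
Proof.
move=> H n x xi dx.
have {}dx : kdiff a n x = 0 by apply/ffunP => S; rewrite [LHS]dx ffunE.
have [||e [w [wi xw]]] := H n (pure_cochain phi x).
- by move=> S Si; rewrite ffunE xi // pure0r.
- by rewrite kdiff_pure_cochain dx => S; rewrite !ffunE pure0r.
have {}xw : pure_cochain phi (ktrans a e x) = kdiff (phi \o a) (n + e) w.
  rewrite -ktrans_pure_cochain; apply/eqP; rewrite -subr_eq0; apply/eqP/ffunP => S.
  by rewrite [LHS]xw ffunE.
pose X : set (cochain s M) := [set y | exists2 v, kdeg_pred i v & y = kdiff a (n + e) v].
have XP : is_submod X.
  split=> [|c _ _ [v vi ->] [v' v'i ->]].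
    by exists 0; [move=> S _; rewrite ffunE | rewrite linear0].
  exists (c *: v + v'); last by rewrite linearP.
  by move=> S Si; rewrite !ffunE vi // v'i // scaler0 addr0.
suff /(span_min XP (fun y Xy => Xy)) [v vi xv] : Defs.span X (ktrans a e x).
  by exists e, v; split=> //; rewrite xv subrr => S; rewrite ffunE.
apply/quo_eq0; apply: faithfully_flat_pure_eq0; rewrite -push_pure xw.
pose P (u : cochain s (tensor phi M)) :=
  push (quo X) (kdiff (phi \o a) (n + e) u) = 0; rewrite -/(P w).
elim/pure_cochain_ind: wi => {w xw} [|u v Pu Pv|b v vi].
- by rewrite /P [kdiff _ _ 0]linear0; exact: linear0.
- rewrite /P [kdiff _ _ (u + v)]linearD; apply: etrans (linearD _ _ _) _.
  by apply: etrans (f_equal2 +%R Pu Pv) _; exact: addr0.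
rewrite /P [kdiff _ _ (b *: _)]linearZ; apply: etrans (linearZ_LR _ _ _) _.
rewrite /= kdiff_pure_cochain push_pure.
have /quo_eq0 dv0 : Defs.span X (kdiff a (n + e) v) by apply: Defs.sub_span; exists v.
by apply: etrans (congr1 (fun z => b *: pure phi 1 z) dv0) _; rewrite pure0r scaler0.
Qed.

End Descent.

(** * The equivalence *)

Lemma ideal_ext_gen (A B : comPzRingType) (phi : {rmorphism A -> B}) (s : nat)
    (a : 'I_s -> A) :
  ideal_ext phi (ideal_gen (range a)) `<=` ideal_gen (range (phi \o a)).
Proof.
have JP := span_submod (range (phi \o a) : set B^o).
apply: (@span_min _ B^o) => // _ [c + <-].
suff: ideal_gen (range a) `<=`
    [set c : A^o | ideal_gen (range (phi \o a)) (phi c)] by apply.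
apply: (@span_min _ A^o) => [|_ [k _ <-]].
  split=> [|b u v uJ vJ]; first by rewrite /= rmorph0; exact: submod0 JP.
  by rewrite /= rmorphD rmorphM; exact: JP.2.
by apply: (@Defs.sub_span _ B^o); exists k.
Qed.

Lemma depth_of_regular_seq (A B : comPzRingType) (phi : {rmorphism A -> B})
    (M : lmodType A) (r s : nat) (a : 'I_s -> A) (f : 'I_r -> B) :
  faithfully_flat phi -> (forall i, ideal_ext phi (ideal_gen (range a)) (f i)) ->
  regular_seq (tensor phi M) f -> enat_le (Some r) (depth a M).
Proof.
move=> phi_ff fI f_reg; apply/depth_acyclic => i lt_ir.
apply: (acyclic_descent phi_ff); apply: acyclic_of_regular_seq f_reg _ i lt_ir.
by move=> j; exact: ideal_ext_gen.
Qed.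

Lemma regular_seq_of_depth (A : comPzRingType) (M : lmodType A) (r s : nat)
    (a : 'I_s -> A) : enat_le (Some r) (depth a M) ->
  exists f : 'I_r -> polyring A 'I_r,
    (forall i, ideal_ext (polyringC A 'I_r) (ideal_gen (range a)) (f i)) /\
    regular_seq (tensor (polyringC A 'I_r) M) f.
Proof.
move=> /depth_acyclic Ha; exists (generic_seq a); split=> [i|].
  apply: generic_elt_ideal => _ /mapP[k _ ->]; exists (a k) => //.
  by apply: (@Defs.sub_span _ A^o); exists k.
exact: regular_seq_iso (@tensor_malgmod_bij _ _ M) (generic_seq_regular Ha).
Qed.

Theorem proposition1p9 (A : comPzRingType) (M : lmodType A) (r : nat)
    (hr : (1 <= r)%N) (I : set A) (s : nat) (a : 'I_s -> A)
    (hI : I = ideal_gen (range a)) :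
  [<-> enat_le (Some r) (depth a M);
       exists (B : comPzRingType) (phi : {rmorphism A -> B}),
         faithfully_flat phi /\
         exists f : 'I_r -> B,
           (forall i, ideal_ext phi I (f i)) /\ regular_seq (tensor phi M) f;
       exists (E : choiceType) (f : 'I_r -> polyring A E),
         (forall i, ideal_ext (polyringC A E) I (f i)) /\
         regular_seq (tensor (polyringC A E) M) f;
       exists f : 'I_r -> polyring A 'I_r,
         (forall i, ideal_ext (polyringC A 'I_r) I (f i)) /\
         regular_seq (tensor (polyringC A 'I_r) M) f].
Proof.
rewrite {}hI.
have poly_ff E := @malgrC_faithfully_flat A {cmonom E}.
tfae.
- move=> /regular_seq_of_depth[f [fI f_reg]].
  by exists (polyring A 'I_r), (polyringC A 'I_r); split; [exact: poly_ff|exists f].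
- move=> [B [phi [phi_ff [f [fI f_reg]]]]]; exists ('I_r : choiceType).
  exact: regular_seq_of_depth (depth_of_regular_seq phi_ff fI f_reg).
- move=> [E [f [fI f_reg]]]; apply: regular_seq_of_depth.
  exact: depth_of_regular_seq (poly_ff E) fI f_reg.
- by move=> [f [fI f_reg]]; exact: depth_of_regular_seq (poly_ff _) fI f_reg.
Qed.
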